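(* Let $X$ be a $C^*$-correspondence over a $C^*$-algebra $A$. If $(\pi,t)$ is a representation of $X$ in a $C^*$-algebra $B$, then there is a unique right tensor representation $\{\pi_{n,m}\}_{n,m\in\mathbb N}$ of the ideal $\mathcal K_X$ in the right tensor $C^*$-precategory $\mathcal T_X$ in $B$ such that $$\pi_{0,0}=\pi,\qquad \pi_{1,0}=t.$$ Denote this representation by $[\pi,t]$. Every right tensor representation of $\mathcal K_X$ is of the form $[\pi,t]$ for some representation $(\pi,t)$ of $X$, and $$\ker[\pi,t]=\mathcal K_X(\ker\pi),$$ i.e. $\ker\pi_{n,m}=\mathcal K(X^{\otimes m},X^{\otimes n}\ker\pi)$ for all $n,m\in\mathbb N$.
   Context: A $C^*$-correspondence $X$ over $A$ is a right Hilbert $A$-module with a $*$-homomorphism $\phi:A\to\mathcal L(X)$; write $a\cdot x=\phi(a)x$. $X^{\otimes0}:=A$, $X^{\otimes n}$ is the $n$-fold interior tensor product. $\mathcal K(Y,Z)=\overline{\mathrm{span}}\{\Theta_{z,y}\}$, $\Theta_{z,y}(w)=z\langle y,w\rangle_A$. For an ideal $I$ of $A$, $\mathcal K(Y,ZI)=\overline{\mathrm{span}}\{\Theta_{z,y}:y\in Y,z\in ZI\}\subset\mathcal K(Y,Z)$. $\mathbb N=\{0,1,2,\dots\}$. A representation $(\pi,t)$ of $X$ in $B$ is a $*$-homomorphism $\pi:A\to B$ and a linear map $t:X\to B$ with $t(x\cdot a)=t(x)\pi(a)$, $t(x)^*t(y)=\pi(\langle x,y\rangle_A)$, $t(a\cdot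 x)=\pi(a)t(x)$. $\mathcal T_X$: spaces $\mathcal T_X(n,m)=\mathcal K(X^{\otimes m},X^{\otimes n})$ if $n=0$ or $m=0$, and $\mathcal L(X^{\otimes m},X^{\otimes n})$ if $n,m\ge1$; identify $\mathcal T_X(0,0)=A$, $\mathcal T_X(n,0)=\mathcal K(A,X^{\otimes n})=X^{\otimes n}$. The right tensoring $\otimes1:\mathcal T_X(n,m)\to\mathcal T_X(n+1,m+1)$ is: $(a\otimes1)(y\otimes x)=ay\otimes x$ for $n,m\ge1$; $a\otimes1=\phi(a)$ for $a\in A=\mathcal T_X(0,0)$; for $x\in X^{\otimes n}=\mathcal T_X(n,0)$, $n\ge 1$, $(x\otimes1)(y)=x\otimes y$ ($y\in X$); for $a\in\mathcal K(X^{\otimes n},A)=\mathcal T_X(0,n)$, $n\ge 1$, $(a\otimes1)(y_1\otimes y_2)=\phi(a(y_1))y_2$ ($y_1\in X^{\otimes n},y_2\in X$). $\otimes1^k$ is the $k$-th iterate. $\mathcal K_X=\{\mathcal K(X^{\otimes m},X^{\otimes n})\}_{n,m\in\mathbb N}$ is an ideal in $\mathcal T_X$ (closed under left and right composition with elements of $\mathcal T_X$). A right tensor representation of $\mathcal K_X$ in $B$ is a family of linear maps $\pi_{n,m}:\mathcal K_X(n,m)\to B$ with $\pi_{n,m}(a)^*=\pi_{m,n}(a^* )$, $\pi_{n,l}(ab)=\pi_{n,m}(a)\pi_{m,l}(b)$ for $a\in\mathcal K_X(n,m)$, $b\in \mathcal K_X(m,l)$, and $\pi_{n,m}(a)\pi_{m+k,l}(b)=\pi_{n+k,l}((a\otimes1^k)b)$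 for all $a\in\mathcal K_X(n,m)$, $b\in\mathcal K_X(m+k,l)$, $k,l,m,n\in\mathbb N$. *)

(* Defs.v *)
From mathcomp Require Import all_boot all_order all_algebra.
From mathcomp Require Import complex.
From mathcomp Require Import boolp classical_sets functions reals.
From mathcomp Require Import topology normedtype.

Set Implicit Arguments.
Unset Strict Implicit.
Unset Printing Implicit Defensive.

Import Order.TTheory GRing.Theory Num.Theory.
Import numFieldNormedType.Exports.
Local Open Scope classical_set_scope.
Local Open Scope ring_scope.

(** * C*-algebras

    C*-algebras are not assumed to be unital, so the multiplication cannot come
    from a MathComp ring structure. The Banach space structure is that of
    [completeNormedModType R[i]]; its norm takes values in [R[i]]. *)

Record cstarAlg (R : realType) := CStarAlg {
  cs_car :> completeNormedModType R[i];
  cmul : cs_car -> cs_car -> cs_car;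
  cstar : cs_car -> cs_car;
  cmulA : forall a b c, cmul a (cmul b c) = cmul (cmul a b) c;
  cmulDl : forall a b c, cmul (a + b) c = cmul a c + cmul b c;
  cmulDr : forall a b c, cmul a (b + c) = cmul a b + cmul a c;
  cmulZl : forall (k : R[i]) a b, cmul (k *: a) b = k *: cmul a b;
  cmulZr : forall (k : R[i]) a b, cmul a (k *: b) = k *: cmul a b;
  cstarD : forall a b, cstar (a + b) = cstar a + cstar b;
  cstarZ : forall (k : R[i]) a, cstar (k *: a) = k^* *: cstar a;
  cstarM : forall a b, cstar (cmul a b) = cmul (cstar b) (cstar a);
  cstarK : forall a, cstar (cstar a) = a;
  cnormM : forall a b, `|cmul a b| <= `|a| * `|b|;
  cnorm_star : forall a, `|cmul (cstar a) a| = `|a| ^+ 2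
}.

Notation "a **c b" := (cmul a b) (at level 40, left associativity).
Notation "a ^#" := (cstar a) (at level 1, left associativity, format "a ^#").

Definition cpositive (R : realType) (A : cstarAlg R) (a : A) : Prop :=
  exists b : A, a = b^# **c b.

Record starhom (R : realType) (A B : cstarAlg R) (f : A -> B) : Prop := StarHom {
  starhomD : forall a b, f (a + b) = f a + f b;
  starhomZ : forall (k : R[i]) a, f (k *: a) = k *: f a;
  starhomM : forall a b, f (a **c b) = f a **c f b;
  starhom_star : forall a, f (a^#) = (f a)^#
}.

(** * Right Hilbert modules

    The inner product is linear in its second variable. Definiteness follows
    from [hnorm]. *)

Record hilbMod (R : realType) (A : cstarAlg R) := HilbMod {
  hm_car :> completeNormedModType R[i];
  hact : hm_car -> A -> hm_car;
  hip : hm_car -> hm_car -> A;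
  hactDl : forall x y a, hact (x + y) a = hact x a + hact y a;
  hactDr : forall x a b, hact x (a + b) = hact x a + hact x b;
  hactZl : forall (k : R[i]) x a, hact (k *: x) a = k *: hact x a;
  hactZr : forall (k : R[i]) x a, hact x (k *: a) = k *: hact x a;
  hactM : forall x a b, hact x (a **c b) = hact (hact x a) b;
  hipDr : forall x y z, hip x (y + z) = hip x y + hip x z;
  hipZr : forall (k : R[i]) x y, hip x (k *: y) = k *: hip x y;
  hipMr : forall x y a, hip x (hact y a) = hip x y **c a;
  hip_star : forall x y, (hip x y)^# = hip y x;
  hip_pos : forall x, cpositive (hip x x);
  hnorm : forall x, `|x| ^+ 2 = `|hip x x|
}.

Notation "x <* a" := (hact x a) (at level 40, left associativity).
Notation "<| x , y |>" := (hip x y) (at level 0, x at level 99, y at level 99).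

Section SelfModule.
Variables (R : realType) (A : cstarAlg R).

Let self_ipZ (k : R[i]) (a b : A) : a^# **c (k *: b) = k *: (a^# **c b).
Proof. exact: cmulZr. Qed.

Let self_ipM (a b c : A) : a^# **c (b **c c) = a^# **c b **c c.
Proof. exact: cmulA. Qed.

Let self_ip_star (a b : A) : (a^# **c b)^# = b^# **c a.
Proof. by rewrite cstarM cstarK. Qed.

Let self_ip_pos (a : A) : cpositive (a^# **c a).
Proof. by exists a. Qed.

Let self_norm (a : A) : `|a| ^+ 2 = `|a^# **c a|.
Proof. by rewrite cnorm_star. Qed.

Definition selfMod : hilbMod A :=
  @HilbMod R A (cs_car A) (@cmul R A) (fun a b => a^# **c b)
    (@cmulDl R A) (@cmulDr R A) (@cmulZl R A) (fun k x a => cmulZr k x a)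
    (@cmulA R A) (fun a => cmulDr (a^#)) self_ipZ self_ipM self_ip_star
    self_ip_pos self_norm.

End SelfModule.

(** * Adjointable and compact operators

    Operators are plain functions; adjointable functions are automatically
    linear, [A]-linear and bounded. *)

Section Operators.
Variables (R : realType) (A : cstarAlg R).
Implicit Types Y Z : hilbMod A.

Definition is_adjoint Y Z (T : Y -> Z) (S : Z -> Y) : Prop :=
  forall y z, <| T y, z |> = <| y, S z |>.

Definition adjointable Y Z : set (Y -> Z) :=
  [set T | exists S, is_adjoint T S].

Definition cspan (V : lmodType R[i]) (S : set V) : set V :=
  [set v | exists (n : nat) (c : 'I_n -> R[i]) (f : 'I_n -> V),
     (forall i, S (f i)) /\ v = \sum_(i < n) c i *: f i].

Definition opnorm_le Y Z (T : Y -> Z) (M : R[i]) : Prop :=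
  forall y, `|T y| <= M * `|y|.

(* closed linear span in the adjointable operators, for the operator norm *)
Definition closed_opspan Y Z (S : set (Y -> Z)) : set (Y -> Z) :=
  [set T | adjointable T /\
     forall e : R[i], 0 < e -> exists2 F, cspan S F & opnorm_le (T - F) e].

Definition theta Y Z (z : Z) (y : Y) : Y -> Z := fun w => z <* <| y, w |>.

Definition compact_into Y Z (D : set Z) : set (Y -> Z) :=
  closed_opspan [set T | exists z y, D z /\ T = theta z y].

Definition compact_op Y Z : set (Y -> Z) := @compact_into Y Z setT.

Definition mod_ideal Z (I : set A) : set Z :=
  [set z | exists w a, I a /\ z = w <* a].

(* [ket z] is the element of K(A, Z) identified with [z] *)
Definition ket Z (z : Z) : selfMod A -> Z := fun a => z <* a.

End Operators.

(** * C*-correspondences and their tensor powers *)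

Record corr (R : realType) (A : cstarAlg R) := Corr {
  cor_mod :> hilbMod A;
  lact : A -> cor_mod -> cor_mod;
  lactDl : forall a b x, lact (a + b) x = lact a x + lact b x;
  lactZl : forall (k : R[i]) a x, lact (k *: a) x = k *: lact a x;
  lactM : forall a b x, lact (a **c b) x = lact a (lact b x);
  lact_adj : forall a, is_adjoint (lact a) (lact (a^#))
}.

(* [Z], together with the map (y, x) |-> y (x) x, is the interior tensor product
   of [Y] and [X]: it is determined up to unitary equivalence by the inner
   product of simple tensors and the density of their span. *)
Record interior_tensor (R : realType) (A : cstarAlg R) (Y : hilbMod A)
    (X : corr A) (Z : hilbMod A) (tau : Y -> X -> Z) : Prop := InteriorTensor {
  itDl : forall y y' x, tau (y + y') x = tau y x + tau y' x;
  itDr : forall y x x', tau y (x + x') = tau y x + tau y x';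
  itZl : forall (k : R[i]) y x, tau (k *: y) x = k *: tau y x;
  itZr : forall (k : R[i]) y x, tau y (k *: x) = k *: tau y x;
  it_bal : forall y a x, tau (y <* a) x = tau y (lact a x);
  it_act : forall y x a, tau y (x <* a) = tau y x <* a;
  it_ip : forall y x y' x',
    <| tau y x, tau y' x' |> = <| x, lact <| y, y' |> x' |>;
  it_dense : closure (cspan [set z | exists y x, z = tau y x]) = setT
}.

Definition powMod (R : realType) (A : cstarAlg R) (X : corr A)
    (P : nat -> hilbMod A) (n : nat) : hilbMod A :=
  match n with 0 => selfMod A | 1 => X | k.+2 => P k end.

(* A model of the interior tensor powers of [X]; [tp_high k] is the (k+2)-fold
   power. *)
Record tensorPowers (R : realType) (A : cstarAlg R) (X : corr A) :=
  TensorPowers {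
    tp_high : nat -> hilbMod A;
    tp_tensor : forall n,
      powMod X tp_high n.+1 -> X -> powMod X tp_high n.+2;
    tp_interior : forall n, interior_tensor (@tp_tensor n)
  }.

Section TensorPrecategory.
Variables (R : realType) (A : cstarAlg R) (X : corr A) (P : tensorPowers X).

Definition tpow (n : nat) : hilbMod A := powMod X (tp_high P) n.

(* For [n = 0] this is the map (a, x) |-> a x, whose range need not be dense. *)
Definition tens (n : nat) : tpow n -> X -> tpow n.+1 :=
  match n return tpow n -> X -> tpow n.+1 with
  | 0 => @lact R A X
  | k.+1 => @tp_tensor R A X P k
  end.

Definition KX (n m : nat) : set (tpow m -> tpow n) :=
  @compact_op R A (tpow m) (tpow n).

Definition TX (n m : nat) : set (tpow m -> tpow n) :=
  match n, m with
  | _.+1, _.+1 => @adjointable R A (tpow m) (tpow n)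
  | _, _ => @KX n m
  end.

(* Since [tens 0] is the left action, the case [m = 0] covers both
   a (x) 1 = phi(a) for a in A and (x (x) 1)(y) = x (x) y, and the case [m > 0]
   covers also (a (x) 1)(y1 (x) y2) = phi(a(y1)) y2 for a in K(X^n, A). *)
Definition rtens_spec (n m : nat) :
    (tpow m -> tpow n) -> (tpow m.+1 -> tpow n.+1) -> Prop :=
  match m return (tpow m -> tpow n) -> (tpow m.+1 -> tpow n.+1) -> Prop with
  | 0 => fun a b => exists2 z : tpow n, a = ket z & b = (fun y => tens z y)
  | k.+1 => fun a b =>
      forall (y : tpow k.+1) (x : X), b (tens y x) = tens (a y) x
  end.

(* a (x) 1; for [a] in [TX n m] it is the only element of [TX n.+1 m.+1]
   satisfying [rtens_spec a]. *)
Definition rtens (n m : nat) (a : tpow m -> tpow n) : tpow m.+1 -> tpow n.+1 :=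
  xget (fun=> 0) [set b | TX b /\ rtens_spec a b].

Fixpoint rtens_iter (k n m : nat) (a : tpow m -> tpow n) :
    tpow (k + m) -> tpow (k + n) :=
  match k return tpow (k + m) -> tpow (k + n) with
  | 0 => a
  | k'.+1 => rtens (@rtens_iter k' n m a)
  end.

(** * Representations

    [rho n m] is a total function on maps from [tpow m] to [tpow n], but only
    its restriction to [KX n m] matters. *)

Variable B : cstarAlg R.

Record representation (pi : A -> B) (t : X -> B) : Prop := Representation {
  rep_hom : starhom pi;
  rep_tD : forall x y, t (x + y) = t x + t y;
  rep_tZ : forall (k : R[i]) x, t (k *: x) = k *: t x;
  rep_tact : forall x a, t (x <* a) = t x **c pi a;
  rep_tip : forall x y, (t x)^# **c t y = pi <| x, y |>;
  rep_tlact : forall a x, t (lact a x) = pi a **c t x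
}.

Definition opfamily := forall n m : nat, (tpow m -> tpow n) -> B.

Record rtensor_rep (rho : opfamily) : Prop := RTensorRep {
  rtrD : forall n m (a b : tpow m -> tpow n), KX a -> KX b ->
    rho n m (a + b) = rho n m a + rho n m b;
  rtrZ : forall n m (k : R[i]) (a : tpow m -> tpow n), KX a ->
    rho n m (k *: a) = k *: rho n m a;
  rtr_star : forall n m (a : tpow m -> tpow n) (b : tpow n -> tpow m),
    KX a -> is_adjoint a b -> (rho n m a)^# = rho m n b;
  rtrM : forall n m l (a : tpow m -> tpow n) (b : tpow l -> tpow m),
    KX a -> KX b -> rho n m a **c rho m l b = rho n l (a \o b);
  rtr_tens : forall k l m n (a : tpow m -> tpow n)
      (b : tpow l -> tpow (k + m)), KX a -> KX b ->
    rho n m a **c rho (k + m)%N l b = rho (k + n)%N l (@rtens_iter k n m a \o b)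
}.

Definition eq_onKX (rho rho' : opfamily) : Prop :=
  forall n m (a : tpow m -> tpow n), KX a -> rho n m a = rho' n m a.

(* [rho] is [pi, t], up to the values outside [KX] *)
Definition integrates (pi : A -> B) (t : X -> B) (rho : opfamily) : Prop :=
  [/\ rtensor_rep rho,
      forall a : A, rho 0 0 (@ket R A (tpow 0) a) = pi a
    & forall x : X, rho 1 0 (@ket R A (tpow 1) x) = t x].

Definition rtr_ker (rho : opfamily) (n m : nat) : set (tpow m -> tpow n) :=
  [set a | KX a /\ rho n m a = 0].

Definition KXideal (I : set A) (n m : nat) : set (tpow m -> tpow n) :=
  @compact_into R A (tpow m) (tpow n) (mod_ideal I).

End TensorPrecategory.

Arguments KX {R A X} P n m _.
Arguments TX {R A X} P n m _.
Arguments rtens_iter {R A X} P k n m a.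
Arguments rtr_ker {R A X P B} rho n m _.
Arguments KXideal {R A X} P I n m _.

(* Main.v *)
Require Import Defs.
From mathcomp Require Import all_boot all_order all_algebra.
From mathcomp Require Import ring lra.
From mathcomp Require Import complex.
From mathcomp Require Import boolp classical_sets functions reals.
From mathcomp Require Import topology normedtype sequences.

Set Implicit Arguments.
Unset Strict Implicit.
Unset Printing Implicit Defensive.

Import Order.TTheory GRing.Theory Num.Theory.
Import numFieldNormedType.Exports.
Local Open Scope classical_set_scope.
Local Open Scope ring_scope.

(* Write [|z>] for [ket z].  A representation (pi, t) is extended to the tensor
   powers by t^(n+1)(xi (x) x) = t^n(xi) t(x); since t^n(xi)^* t^n(eta) =
   pi <xi, eta>, it is isometric up to pi.  The value at a compact operator [a]
   is then the unique [b] in the closed span of the t^n(xi) t^m(eta)^* such that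
   b t^m(zeta) = t^n(a zeta), and every algebraic identity follows from this
   characterisation.  Conversely a right tensor representation satisfies
   rho(|xi> <eta|) = rho(|xi>) rho(|eta>)^*, hence is determined by its values
   on kets as soon as it is continuous.  A compact [a] with rho(a) = 0 maps into
   the vectors zeta with <zeta, zeta> in ker pi, which approximate units of
   ker pi push into X^n ker pi.

   Positivity is avoided: spectral estimates come from writing a small
   self-adjoint h as (u + u^* ) / 2 with u = h + i sqrt (1 - h^2) unitary, the
   square root being the fixed point of a contraction.  All norm bounds are
   therefore only up to a constant. *)

(** The recurring obstacle is that finite sums, of simple tensors or of operators [theta z y], do
    not determine their terms, so a map prescribed term by term on such sums exists only once it is
    bounded by the norm of the sum. For t^(n+1) the inner product formula itself gives the bound.
    For [T (x) 1] and for the map from finite rank operators to [B] the usual argument uses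
    positivity of Gram matrices; here repeated Cauchy-Schwarz inequalities compare the first power
    of a self-adjoint operator, at one fixed vector, with the growth of its powers of exponent 2^n,
    and any constant disappears in the limit.

    A C*-algebra is treated as a Hilbert module over itself, with elements acting by left
    multiplication, so one functional calculus serves algebra elements, compact operators and their
    images in [B].

    Power 0 always needs its own argument: the products [a x] need not span a dense part of [X], so
    density of simple tensors is available only from power 2 on. *)

Local Notation "r *r v" := (r%:C%C *: v) (at level 40).

(** * Real-valued norms *)

Section RealNorm.
Variables (R : realType) (V : normedModType R[i]).
Implicit Types (v w : V) (r : R) (k : R[i]).

(** Norms take values in [R[i]], whose order is only partial; the real part makes case analysis on
    the order and linear arithmetic available. *)
Definition nrm v : R := complex.Re `|v|.

Lemma ReK k : 0 <= k -> k = (complex.Re k)%:C%C.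
Proof. by move=> k0; rewrite RRe_real // ger0_real. Qed.

Lemma Re_ge0 k : 0 <= k -> 0 <= complex.Re k.
Proof. by move=> k0; rewrite -ler0c -ReK. Qed.

Lemma normE v : `|v| = (nrm v)%:C%C.
Proof. exact/ReK. Qed.

Lemma nrm_ge0 v : 0 <= nrm v.
Proof. by rewrite -ler0c -normE. Qed.

Lemma nrm0 : nrm 0 = 0.
Proof. by rewrite /nrm normr0. Qed.

Lemma nrm_eq0 v : nrm v = 0 -> v = 0.
Proof. by move=> v0; apply/normr0_eq0; rewrite normE v0. Qed.

Lemma nrmN v : nrm (- v) = nrm v.
Proof. by rewrite /nrm normrN. Qed.

Lemma nrmBC v w : nrm (v - w) = nrm (w - v).
Proof. by rewrite -nrmN opprB. Qed.

Lemma nrmD v w : nrm (v + w) <= nrm v + nrm w.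
Proof. by rewrite -lecR rmorphD /= -!normE ler_normD. Qed.

Lemma nrmB v w : nrm (v - w) <= nrm v + nrm w.
Proof. by rewrite -(nrmN w) nrmD. Qed.

Lemma nrm_dist v w x : nrm (v - w) <= nrm (v - x) + nrm (x - w).
Proof. by rewrite -[v - w](subrKA x) nrmD. Qed.

Lemma nrmZ k v : nrm (k *: v) = complex.Re `|k| * nrm v.
Proof.
rewrite {1}/nrm normrZ [`|v|]normE [`|k|]ReK //.
by rewrite -rmorphM.
Qed.

Lemma nrmZr r v : nrm (r *r v) = `|r| * nrm v.
Proof. by rewrite nrmZ normc_def /= expr0n addr0 sqrtr_sqr. Qed.

Lemma nrmMn v n : nrm (v *+ n) = nrm v *+ n.
Proof. by apply: complexI; rewrite -normE normrMn normE rmorphMn. Qed.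

Lemma nrm_le0P v : (forall e, 0 < e -> nrm v <= e) -> v = 0.
Proof.
move=> h; apply: nrm_eq0; apply/eqP; rewrite eq_le nrm_ge0 andbT.
by apply/ler_addgt0Pr => e e0; rewrite add0r h.
Qed.

End RealNorm.

(** * Geometric convergence *)

Section Completeness.
Variables (R : realType).

Lemma expr_small (q K e : R) : 0 <= q -> q < 1 -> 0 < e ->
  exists n, K * q ^+ n <= e.
Proof.
move=> q0 q1 e0; have q1' : `|q| < 1 by rewrite ger0_norm.
have [K0|K0] := leP K 0.
  by exists 0; apply: le_trans (ltW e0); rewrite mulr1.
have /cvgrPdist_lt /(_ (e / K)) := cvg_expr q1'.
rewrite divr_gt0 // => /(_ isT) [N _ /(_ N (leqnn N))] /=.
rewrite sub0r normrN ger0_norm ?exprn_ge0 // => h.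
by exists N; rewrite mulrC -ler_pdivlMr // ltW.
Qed.

(** The explicit rate matters for operators: their limits are taken pointwise, and uniformity is
    read off from the dependence of the constant on the vector. *)
Lemma geom_cvg (V : completeNormedModType R[i]) (u : nat -> V) (K q : R) :
  0 <= q -> q < 1 -> (forall n, nrm (u n.+1 - u n) <= K * q ^+ n) ->
  exists l, forall n, nrm (u n - l) <= K / (1 - q) * q ^+ n.
Proof.
move=> q0 q1 hu; have q1' : 0 < 1 - q by rewrite subr_gt0.
have K0 : 0 <= K by have := hu 0; rewrite mulr1; apply/le_trans/nrm_ge0.
have step n m : nrm (u (n + m)%N - u n) <= K / (1 - q) * q ^+ n.
  (* The difference of powers telescopes, so the induction on [m] closes with equality;
     [q ^+ (n + m)] is dropped only afterwards. *)
  suff h : nrm (u (n + m)%N - u n) <= K / (1 - q) * (q ^+ n - q ^+ (n + m)).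
    apply: le_trans h _; apply: ler_wpM2l; first by rewrite divr_ge0 // ltW.
    by rewrite gerBl exprn_ge0.
  elim: m => [|m IH]; first by rewrite addn0 !subrr nrm0 mulr0.
  rewrite addnS; apply: le_trans (nrm_dist _ _ (u (n + m)%N)) _.
  apply: le_trans (lerD (hu _) IH) _.
  rewrite le_eqVlt; apply/orP; left; apply/eqP; rewrite exprS; field.
  by rewrite lt0r_neq0.
have cu : cvg (u @ \oo).
  apply/cauchy_cvgP/cauchy_exP => e e0.
  have e1 : 0 < complex.Re e by rewrite -ltcR -ReK // ltW.
  have e2 : 0 < complex.Re e / 2 by rewrite divr_gt0.
  have [N hN] := expr_small (K / (1 - q)) q0 q1 e2.
  exists (u N); exists N => // n /= Nn; rewrite -ball_normE /=.
  rewrite normE nrmBC -(subnKC Nn) [e]ReK ?ltW // ltcR.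
  apply: le_lt_trans (step _ _) _; apply: le_lt_trans hN _.
  by rewrite ltr_pdivrMr // ltr_pMr // ltrDl.
exists (lim (u @ \oo)) => n; apply/ler_addgt0Pr => e e0.
move/cvgrPdist_lt: cu => /(_ e%:C%C); rewrite ltcR => /(_ e0) [N _ hN].
have := hN (n + N)%N (leq_addl _ _); rewrite /= normE ltcR => /ltW h.
rewrite (le_trans (nrm_dist _ _ (u (n + N)%N))) // lerD //.
  by rewrite nrmBC step.
by rewrite nrmBC.
Qed.

End Completeness.

(** * C*-algebras and Hilbert modules *)

Section CStarAlgebra.
Variables (R : realType) (A : cstarAlg R).
Implicit Types (a b c : A) (r : R).

Lemma cmul0l a : 0 **c a = 0.
Proof. by have := cmulZl 0 0 a; rewrite !scale0r. Qed.

Lemma cmul0r a : a **c 0 = 0.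
Proof. by have := cmulZr 0 a 0; rewrite !scale0r. Qed.

Lemma cmulNl a b : (- a) **c b = - (a **c b).
Proof. by rewrite -scaleN1r cmulZl scaleN1r. Qed.

Lemma cmulNr a b : a **c (- b) = - (a **c b).
Proof. by rewrite -scaleN1r cmulZr scaleN1r. Qed.

Lemma cmulBl a b c : (a - b) **c c = a **c c - b **c c.
Proof. by rewrite cmulDl cmulNl. Qed.

Lemma cmulBr a b c : a **c (b - c) = a **c b - a **c c.
Proof. by rewrite cmulDr cmulNr. Qed.

Lemma cmul_suml (I : Type) (s : seq I) (F : I -> A) b :
  (\sum_(i <- s) F i) **c b = \sum_(i <- s) F i **c b.
Proof. exact: (big_morph (fun a => a **c b) (fun a c => cmulDl a c b) (cmul0l b)). Qed.

Lemma cmul_sumr (I : Type) (s : seq I) (F : I -> A) b :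
  b **c (\sum_(i <- s) F i) = \sum_(i <- s) b **c F i.
Proof. exact: (big_morph _ (cmulDr b) (cmul0r b)). Qed.

Lemma conj_real r : (r%:C%C : R[i])^* = r%:C%C.
Proof. by apply: conj_Creal; rewrite complex_real. Qed.

Lemma cstarZr r a : (r *r a)^# = r *r a^#.
Proof. by rewrite cstarZ conj_real. Qed.

Lemma cstar0 : (0 : A)^# = 0.
Proof. by have := cstarZ 0 (0 : A); rewrite rmorph0 !scale0r. Qed.

Lemma cstarN a : (- a)^# = - a^#.
Proof. by rewrite -scaleN1r cstarZ rmorphN rmorph1 scaleN1r. Qed.

Lemma cstarB a b : (a - b)^# = a^# - b^#.
Proof. by rewrite cstarD cstarN. Qed.

Lemma cstar_sum (I : Type) (s : seq I) (F : I -> A) :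
  (\sum_(i <- s) F i)^# = \sum_(i <- s) (F i)^#.
Proof. exact: (big_morph _ (@cstarD R A) cstar0). Qed.

Lemma nrm_mul a b : nrm (a **c b) <= nrm a * nrm b.
Proof. by rewrite -lecR rmorphM /= -!normE cnormM. Qed.

Lemma nrm_star_mul a : nrm (a^# **c a) = nrm a ^+ 2.
Proof. by apply: complexI; rewrite -normE cnorm_star rmorphXn /= -normE. Qed.

Lemma nrm_star a : nrm (a^#) = nrm a.
Proof.
suff le b : nrm b <= nrm (b^#).
  by apply/eqP; rewrite eq_le le -{2}(cstarK a) le.
have := nrm_mul (b^#) b; rewrite nrm_star_mul expr2.
have [->|] := eqVneq (nrm b) 0; first by rewrite nrm_ge0.
by rewrite neq_lt ltNge nrm_ge0 /= => b0; rewrite ler_pM2r.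
Qed.

Lemma star_mul_eq0 a : a^# **c a = 0 -> a = 0.
Proof.
move=> h; apply/nrm_eq0/eqP.
by rewrite -sqrf_eq0 -nrm_star_mul h nrm0.
Qed.

Lemma mul_star_eq0 a : a **c a^# = 0 -> a = 0.
Proof.
by move=> h; rewrite -(cstarK a) (@star_mul_eq0 (a^#)) ?cstar0 // cstarK.
Qed.

End CStarAlgebra.

Section HilbertModule.
Variables (R : realType) (A : cstarAlg R) (Y : hilbMod A).
Implicit Types (x y z : Y) (a b : A) (r : R) (k : R[i]).

Lemma hact0l a : (0 : Y) <* a = 0.
Proof. by have := hactZl 0 (0 : Y) a; rewrite !scale0r. Qed.

Lemma hactNl x a : (- x) <* a = - (x <* a).
Proof. by rewrite -scaleN1r hactZl scaleN1r. Qed.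

Lemma hactBl x y a : (x - y) <* a = x <* a - y <* a.
Proof. by rewrite hactDl hactNl. Qed.

Lemma hip0r x : <| x, (0 : Y) |> = 0.
Proof. by have := hipZr 0 x (0 : Y); rewrite !scale0r. Qed.

Lemma hipNr x y : <| x, - y |> = - <| x, y |>.
Proof. by rewrite -scaleN1r hipZr scaleN1r. Qed.

Lemma hipBr x y z : <| x, y - z |> = <| x, y |> - <| x, z |>.
Proof. by rewrite hipDr hipNr. Qed.

Lemma hip_sumr (I : Type) (s : seq I) (F : I -> Y) x :
  <| x, \sum_(i <- s) F i |> = \sum_(i <- s) <| x, F i |>.
Proof. exact: (big_morph _ (hipDr x) (hip0r x)). Qed.

Lemma hipDl x y z : <| x + y, z |> = <| x, z |> + <| y, z |>.
Proof. by rewrite -hip_star hipDr cstarD !hip_star. Qed.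

Lemma hip0l x : <| (0 : Y), x |> = 0.
Proof. by rewrite -hip_star hip0r cstar0. Qed.

Lemma hipNl x y : <| - x, y |> = - <| x, y |>.
Proof. by rewrite -hip_star hipNr cstarN hip_star. Qed.

Lemma hipBl x y z : <| x - y, z |> = <| x, z |> - <| y, z |>.
Proof. by rewrite hipDl hipNl. Qed.

Lemma hipZl k x y : <| k *: x, y |> = k^* *: <| x, y |>.
Proof. by rewrite -hip_star hipZr cstarZ hip_star. Qed.

Lemma hipZlr r x y : <| r *r x, y |> = r *r <| x, y |>.
Proof. by rewrite hipZl conj_real. Qed.

Lemma hip_suml (I : Type) (s : seq I) (F : I -> Y) x :
  <| \sum_(i <- s) F i, x |> = \sum_(i <- s) <| F i, x |>.
Proof. exact: (big_morph (fun y => <| y, x |>) (fun y z => hipDl y z x) (hip0l x)). Qed.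

Lemma hipMl x y a : <| x <* a, y |> = a^# **c <| x, y |>.
Proof. by rewrite -hip_star hipMr cstarM hip_star. Qed.

Lemma nrm_hip x : nrm <| x, x |> = nrm x ^+ 2.
Proof. by apply: complexI; rewrite -normE -hnorm rmorphXn /= -normE. Qed.

Lemma hip_eq0 x : <| x, x |> = 0 -> x = 0.
Proof.
move=> h; apply/nrm_eq0/eqP.
by rewrite -sqrf_eq0 -nrm_hip h nrm0.
Qed.

Lemma hip_inj x y : (forall z, <| z, x |> = <| z, y |>) -> x = y.
Proof.
move=> h; apply/eqP; rewrite -subr_eq0; apply/eqP/hip_eq0.
by rewrite hipBr h subrr.
Qed.

Lemma nrm_act x a : nrm (x <* a) <= nrm x * nrm a.
Proof.
rewrite -(@ler_pXn2r _ 2) // ?nnegrE ?mulr_ge0 ?nrm_ge0 //.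
rewrite -nrm_hip hipMr hipMl (le_trans (nrm_mul _ _)) //.
rewrite (le_trans (ler_wpM2r (nrm_ge0 _) (nrm_mul _ _))) //.
by rewrite nrm_star nrm_hip exprMn mulrAC -expr2 mulrC.
Qed.

(* The polarisation identity and the triangle inequality suffice here; the
   sharp constant 1 would need positivity. *)
Lemma cauchy_schwarz x y : nrm <| x, y |> <= 2 * (nrm x * nrm y).
Proof.
have nn (B : normedModType R[i]) (u : B) : u != 0 -> 0 < nrm u.
  rewrite lt_neqAle nrm_ge0 andbT => u0; apply/eqP => /esym/nrm_eq0.
  exact/eqP.
have [->|/nn x0] := eqVneq x 0; first by rewrite hip0l !nrm0 mul0r mulr0.
have [->|/nn y0] := eqVneq y 0; first by rewrite hip0r !nrm0 !mulr0.
set c := <| y, x |>; have -> : nrm <| x, y |> = nrm c by rewrite -hip_star nrm_star.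
have [->|/nn c0] := eqVneq c 0.
  by rewrite nrm0 !mulr_ge0 // nrm_ge0.
(* This scale gives [z] at most the norm of [x], while <x, z> becomes the self-adjoint element l c^#
   c, so polarisation isolates 4 l c^# c. *)
set l := nrm x / (nrm y * nrm c).
have l0 : 0 < l by rewrite divr_gt0 // mulr_gt0.
pose z := l *r (y <* c).
have nz : nrm z <= nrm x.
  rewrite nrmZr gtr0_norm // (le_trans (ler_wpM2l (ltW l0) (nrm_act _ _))) //.
  by rewrite /l mulfVK // mulf_neq0 // gt_eqF.
have xz : <| x, z |> = l *r (c^# **c c) by rewrite hipZr hipMr hip_star.
have zx : <| z, x |> = l *r (c^# **c c) by rewrite -hip_star xz cstarZr cstarM cstarK.
have pol : <| x + z, x + z |> - <| x - z, x - z |> = l *r (c^# **c c) *+ 4.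
  rewrite !hipDl !hipDr !hipNl !hipNr xz zx !opprK.
  set u := _ *: _; set p := <| x, x|>; set q := <| z, z |>.
  rewrite [- u + q]addrC opprD !opprB addrACA [p + u]addrC [u + p + _]addrACA.
  rewrite [u + q + _]addrACA !subrr !addr0.
  by rewrite !mulrS mulr0n addr0 !addrA.
have h3 := nrmB <| x + z, x + z |> <| x - z, x - z |>.
have h1 : nrm (x + z) ^+ 2 <= (nrm x + nrm x) ^+ 2.
  by rewrite lerXn2r ?nnegrE ?addr_ge0 ?nrm_ge0 // (le_trans (nrmD _ _)) ?lerD.
have h2 : nrm (x - z) ^+ 2 <= (nrm x + nrm x) ^+ 2.
  by rewrite lerXn2r ?nnegrE ?addr_ge0 ?nrm_ge0 // (le_trans (nrmB _ _)) ?lerD.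
have {}h3 : 4 * (nrm x * nrm c / nrm y) <= nrm (x + z) ^+ 2 + nrm (x - z) ^+ 2.
  rewrite -!nrm_hip (le_trans _ h3) // pol nrmMn nrmZr nrm_star_mul.
  rewrite gtr0_norm // le_eqVlt; apply/orP; left; apply/eqP.
  by rewrite /l -mulr_natl; field; rewrite !gt_eqF.
have : nrm x * nrm c / nrm y <= 2 * nrm x ^+ 2 by lra.
rewrite ler_pdivrMr // => h.
have : nrm x * nrm c <= nrm x * (2 * (nrm x * nrm y)) by rewrite (le_trans h) //; lra.
by rewrite ler_pM2l.
Qed.

End HilbertModule.

(** * Bounded and adjointable operators *)

Lemma sqr_le_mul (R : realType) (x c : R) : 0 <= x -> 0 <= c ->
  x ^+ 2 <= c * x -> x <= c.
Proof.
move=> x0 c0; have [->//|] := eqVneq x 0.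
by rewrite neq_lt ltNge x0 /= => xp; rewrite expr2 ler_pM2r.
Qed.

Section BoundedOperators.
Variables (R : realType).
Implicit Types V W U : normedModType R[i].

(** A relation instead of an operator norm: no supremum is formed, and bounds with lossy constants
    compose directly. *)
Definition opb V W (T : V -> W) (M : R) := forall y, nrm (T y) <= M * nrm y.

Lemma opb_le V W (T : V -> W) M N : M <= N -> opb T M -> opb T N.
Proof. by move=> MN h y; rewrite (le_trans (h y)) // ler_wpM2r // nrm_ge0. Qed.

Lemma opb0 V W M : 0 <= M -> opb (0 : V -> W) M.
Proof. by move=> M0 y; rewrite [nrm _]nrm0 mulr_ge0 // nrm_ge0. Qed.

Lemma opbD V W (S T : V -> W) M N : opb S M -> opb T N -> opb (S + T) (M + N).
Proof. by move=> h k y; rewrite fctE (le_trans (nrmD _ _)) // mulrDl lerD. Qed.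

Lemma opbN V W (T : V -> W) M : opb T M -> opb (- T) M.
Proof. by move=> h y; rewrite fctE nrmN. Qed.

Lemma opbB V W (S T : V -> W) M N : opb S M -> opb T N -> opb (S - T) (M + N).
Proof. by move=> h k; apply: opbD => //; apply: opbN. Qed.

Lemma opbC V W (S T : V -> W) M : opb (S - T) M -> opb (T - S) M.
Proof. by move=> h; rewrite -(opprB S T); apply: opbN. Qed.

Lemma opb_dist V W (S T F : V -> W) M N :
  opb (S - F) M -> opb (F - T) N -> opb (S - T) (M + N).
Proof. by move=> h k; rewrite -(subrKA F); apply: opbD. Qed.

Lemma opbZ V W (T : V -> W) r M : opb T M -> opb (r *r T) (`|r| * M).
Proof. by move=> h y; rewrite fctE nrmZr -mulrA ler_wpM2l. Qed.

Lemma opb_comp V W U (S : W -> U) (T : V -> W) M N : 0 <= M ->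
  opb S M -> opb T N -> opb (S \o T) (M * N).
Proof. by move=> M0 h k y; rewrite (le_trans (h _)) // -mulrA ler_wpM2l. Qed.

Lemma opb_eq V W (S T : V -> W) : (forall e, 0 < e -> opb (S - T) e) -> S = T.
Proof.
move=> h; apply/funext => y; apply/eqP; rewrite -subr_eq0; apply/eqP.
have y1 : 0 < nrm y + 1 by rewrite ltr_wpDl // nrm_ge0.
apply: nrm_le0P => e e0; have := h _ (divr_gt0 e0 y1) y.
rewrite fctE => /le_trans; apply; rewrite mulrAC ler_pdivrMr // ler_pM2l //.
by rewrite lerDl.
Qed.

End BoundedOperators.

Section Adjoints.
Variables (R : realType) (A : cstarAlg R).
Implicit Types Y Z W : hilbMod A.

Lemma opnorm_leE Y Z (T : Y -> Z) (M : R) : opnorm_le T M%:C%C <-> opb T M.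
Proof.
by split=> h y; move: (h y); rewrite !normE -rmorphM /= lecR.
Qed.

Lemma adj_sym Y Z (T : Y -> Z) (S : Z -> Y) : is_adjoint T S -> is_adjoint S T.
Proof. by move=> h z y; rewrite -hip_star -h hip_star. Qed.

Section Linearity.
Variables (Y Z : hilbMod A) (T : Y -> Z) (S : Z -> Y).
Hypothesis TS : is_adjoint T S.
Let ST := adj_sym TS.

Lemma adj_add x y : T (x + y) = T x + T y.
Proof. by apply: hip_inj => z; rewrite hipDr -!ST hipDr. Qed.

Lemma adj_scale k y : T (k *: y) = k *: T y.
Proof. by apply: hip_inj => z; rewrite hipZr -!ST hipZr. Qed.

Lemma adj_opp y : T (- y) = - T y.
Proof. by rewrite -scaleN1r adj_scale scaleN1r. Qed.

Lemma adj_sub x y : T (x - y) = T x - T y.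
Proof. by rewrite adj_add adj_opp. Qed.

Lemma adj_0 : T 0 = 0.
Proof. by rewrite -(subrr 0) adj_sub subrr. Qed.

Lemma adj_act y a : T (y <* a) = T y <* a.
Proof. by apply: hip_inj => z; rewrite hipMr -!ST hipMr. Qed.

Lemma adj_sum (I : Type) (s : seq I) (F : I -> Y) :
  T (\sum_(i <- s) F i) = \sum_(i <- s) T (F i).
Proof. exact: (big_morph _ adj_add adj_0). Qed.

(** Since |S z|^2 = |<T S z, z>|, the factor 2 is the one of [cauchy_schwarz]. *)
Lemma adj_opb M : 0 <= M -> opb T M -> opb S (2 * M).
Proof.
move=> M0 h z; apply: sqr_le_mul; rewrite ?mulr_ge0 ?nrm_ge0 //.
rewrite -nrm_hip -TS (le_trans (cauchy_schwarz _ _)) //.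
have := ler_wpM2r (nrm_ge0 z) (h (S z)); lra.
Qed.

End Linearity.

Lemma adj_funD Y Z (T T' : Y -> Z) (S S' : Z -> Y) :
  is_adjoint T S -> is_adjoint T' S' -> is_adjoint (T + T') (S + S').
Proof. by move=> h k y z; rewrite !fctE hipDl hipDr h k. Qed.

Lemma adj_funN Y Z (T : Y -> Z) (S : Z -> Y) :
  is_adjoint T S -> is_adjoint (- T) (- S).
Proof. by move=> h y z; rewrite !fctE hipNl hipNr h. Qed.

Lemma adj_funB Y Z (T T' : Y -> Z) (S S' : Z -> Y) :
  is_adjoint T S -> is_adjoint T' S' -> is_adjoint (T - T') (S - S').
Proof. by move=> h k; apply: adj_funD => //; apply: adj_funN. Qed.

Lemma adj_funZ Y Z (T : Y -> Z) (S : Z -> Y) k :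
  is_adjoint T S -> is_adjoint (k *: T) (k^* *: S).
Proof. by move=> h y z; rewrite !fctE hipZl hipZr h. Qed.

Lemma adj_funZr Y Z (T : Y -> Z) (S : Z -> Y) r :
  is_adjoint T S -> is_adjoint (r *r T) (r *r S).
Proof. by move=> /(@adj_funZ _ _ _ _ r%:C%C); rewrite conj_real. Qed.

Lemma adj_comp Y Z W (T : Z -> W) (S : W -> Z) (T' : Y -> Z) (S' : Z -> Y) :
  is_adjoint T S -> is_adjoint T' S' -> is_adjoint (T \o T') (S' \o S).
Proof. by move=> h k y z /=; rewrite h k. Qed.

(** Pointwise limits suffice: the constant from [geom_cvg] is proportional to [nrm y], which makes
    the convergence uniform, and self-adjointness passes to the limit through the inner product. *)
Lemma op_complete Y (u : nat -> Y -> Y) (K q : R) :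
  0 <= q -> q < 1 -> (forall n, is_adjoint (u n) (u n)) ->
  (forall n, opb (u n.+1 - u n) (K * q ^+ n)) ->
  exists2 l, is_adjoint l l & forall n, opb (u n - l) (K / (1 - q) * q ^+ n).
Proof.
move=> q0 q1 sa hu.
have lim y : exists l, forall n, nrm (u n y - l) <= (K * nrm y) / (1 - q) * q ^+ n.
  apply: geom_cvg => // n.
  by rewrite mulrAC; exact: hu.
have [l hl] := choice lim; exists l => [y z|n y]; last first.
  by have := hl y n; rewrite fctE; lra.
apply/eqP; rewrite -subr_eq0; apply/eqP/nrm_le0P => e e0.
pose M := (2 * (2 * (K * nrm y / (1 - q) * nrm z)))
        + (2 * (2 * (K * nrm z / (1 - q) * nrm y))).
have [n hn] := expr_small M q0 q1 e0; apply: le_trans hn.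
rewrite (_ : <| l y, z |> - <| y, l z |> =
  <| l y - u n y, z |> - <| y, l z - u n z |>); last first.
  by rewrite hipBl hipBr sa opprB addrA subrK.
apply: le_trans (nrmB _ _) _.
have := cauchy_schwarz (l y - u n y) z.
have := cauchy_schwarz y (l z - u n z).
rewrite !(nrmBC (l _)) => h1 h2.
have h3 := ler_wpM2r (nrm_ge0 z) (hl y n).
have h4 := ler_wpM2l (nrm_ge0 y) (hl z n).
have h5 := le_trans (nrm_ge0 _) h1.
have h6 := le_trans (nrm_ge0 _) h2.
by rewrite /M; lra.
Qed.

(** Banach's fixed point theorem with [opb] in place of a metric. The set [D] carries the invariants
    that the iteration has to preserve. *)
Lemma op_fixpoint Y (D : set (Y -> Y)) (Phi : (Y -> Y) -> Y -> Y) f0 (K q : R) :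
  0 <= q -> q < 1 -> 0 <= K ->
  (forall f, D f -> is_adjoint f f) ->
  (forall l, is_adjoint l l ->
     (forall e, 0 < e -> exists2 f, D f & opb (f - l) e) -> D l) ->
  (forall f, D f -> D (Phi f)) ->
  (forall f g r, D f -> D g -> 0 <= r -> opb (f - g) r ->
     opb (Phi f - Phi g) (q * r)) ->
  D f0 -> opb (Phi f0 - f0) K -> exists2 l, D l & Phi l = l.
Proof.
move=> q0 q1 K0 Dsa Dlim DPhi contr D0 h0.
pose u n := iter n Phi f0; have Du n : D (u n) by elim: n => //= n; apply: DPhi.
have hu n : opb (u n.+1 - u n) (K * q ^+ n).
  elim: n => [|n IH]; first by rewrite mulr1.
  by rewrite exprS mulrCA; apply: (contr _ _ _ (Du _) (Du _) _ IH); rewrite mulr_ge0 // exprn_ge0.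
have [l lsa hl] := op_complete q0 q1 (fun n => Dsa _ (Du n)) hu.
have small e : 0 < e -> exists2 n, K / (1 - q) * q ^+ n <= e & opb (u n - l) e.
  move=> e0; have [n hn] := expr_small (K / (1 - q)) q0 q1 e0.
  by exists n => //; exact: opb_le hn (hl n).
have Dl : D l.
  by apply: Dlim => // e /small [n _ hn]; exists (u n).
exists l => //; apply: opb_eq => e e0.
have [n hK hn] := small _ (divr_gt0 e0 (ltr0n R 2)).
have c0 : 0 <= K / (1 - q) * q ^+ n.
  by rewrite mulr_ge0 ?exprn_ge0 // divr_ge0 // subr_ge0 ltW.
have h1 := contr _ _ _ (Du n) Dl c0 (hl n).
have h2 := hl n.+1; rewrite exprS in h2.
have := opb_dist (opbC h1) h2; apply: opb_le.
have : q * (K / (1 - q) * q ^+ n) <= 1 * (K / (1 - q) * q ^+ n).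
  by rewrite ler_wpM2r // ltW.
lra.
Qed.

End Adjoints.

(** * Functional calculus *)

Lemma sub_sub_sub (V : zmodType) (a b c d : V) : (a - b) - (c - d) = (a - c) - (b - d).
Proof. by rewrite !opprB [d - c]addrC addrACA [- b + d]addrC. Qed.

Section FunctionalCalculus.
Variables (R : realType) (A : cstarAlg R) (Y : hilbMod A).
Implicit Types (f g h k l : Y -> Y) (y z : Y).

(** Real scalars and no unit, so that compact operators and left multiplications by a non-unital
    algebra both qualify. Limits are asked to be self-adjoint because those are the limits that
    [op_complete] produces. *)
Record closed_alg (J : set (Y -> Y)) : Prop := ClosedAlg {
  ca_add : forall f g, J f -> J g -> J (f + g);
  ca_scale : forall (r : R) f, J f -> J (r *r f);
  ca_comp : forall f g, J f -> J g -> J (f \o g);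
  ca_lim : forall l, is_adjoint l l ->
    (forall e : R, 0 < e -> exists2 f, J f & opb (f - l) e) -> J l
}.

Lemma ca_sub J f g : closed_alg J -> J f -> J g -> J (f - g).
Proof.
move=> hJ Jf Jg; rewrite -scaleN1r (_ : -1 = (-1)%:C%C); last by rewrite rmorphN1.
by apply: (ca_add hJ) => //; apply: (ca_scale hJ).
Qed.

Lemma comm_lim (D : set (Y -> Y)) h l : is_adjoint h h -> opb h 2^-1 ->
  (forall f, D f -> f \o h = h \o f) ->
  (forall e : R, 0 < e -> exists2 f, D f & opb (f - l) e) -> l \o h = h \o l.
Proof.
move=> hh h1 Dh hl; apply: opb_eq => e e0.
have [f Df hf] := hl _ e0.
have b1 : opb ((l \o h) - (f \o h)) (e * 2^-1).
  rewrite (_ : _ - _ = (l - f) \o h); last by [].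
  by apply: (opb_comp _ (opbC hf) h1); lra.
have b2 : opb ((f \o h) - (h \o l)) (2^-1 * e).
  rewrite (Dh _ Df) (_ : _ - _ = h \o (f - l)).
    by apply: (opb_comp _ h1 hf); rewrite invr_ge0.
  by apply/funext => y; rewrite !fctE (adj_sub hh).
by have := opb_dist b1 b2; apply: opb_le; lra.
Qed.

(* The fixed point iteration [k <- (h^2 + k^2) / 2] yields
   [k = 1 - sqrt (1 - h^2)] without leaving the non-unital algebra [J]. *)
Lemma sqrt_op J h : closed_alg J -> J h -> is_adjoint h h -> opb h 2^-1 ->
  exists k, [/\ J k, is_adjoint k k, k \o h = h \o k &
    forall y, h (h y) = k y + k y - k (k y)].
Proof.
move=> hJ Jh hh h1.
have i2 : 0 <= 2^-1 :> R by rewrite invr_ge0.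
(* The radius 1/2 is invariant because (1/4 + 1/4) / 2 <= 1/2, and f^2 - g^2 = f (f - g) + (f - g) g
   shows that [Phi] contracts by 1/2 on this ball. *)
pose D := [set f | [/\ J f, is_adjoint f f, f \o h = h \o f & opb f 2^-1]].
pose Phi f := 2^-1 *r ((h \o h) + (f \o f)).
have DPhi f : D f -> D (Phi f).
  move=> [Jf ff fh f1]; split.
  - by apply/(ca_scale hJ)/(ca_add hJ); apply: (ca_comp hJ).
  - by apply/adj_funZr/adj_funD; apply: adj_comp.
  - apply/funext => y; rewrite /Phi !fctE (adj_scale hh) (adj_add hh) /=.
    have fhy z : f (h z) = h (f z) by rewrite -[LHS]/((f \o h) z) fh.
    by rewrite !fhy.
  - have := opbD (opb_comp i2 h1 h1) (opb_comp i2 f1 f1).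
    by move/(opbZ 2^-1); apply: opb_le; rewrite ger0_norm //; lra.
have D0 : D 0.
  have -> : 0 = 0%:C%C *: h by rewrite scale0r.
  split; [exact: (ca_scale hJ)|exact: adj_funZr| |].
    by apply/funext => y; rewrite !fctE (adj_scale hh).
  by rewrite scale0r; apply: opb0.
have [k [Jk kk kh k1] hk] : exists2 k, D k & Phi k = k.
  apply: (@op_fixpoint _ _ _ D Phi 0 2^-1 2^-1) => //; first lra.
  - by move=> f [].
  - move=> l ll hl; split => //.
    + apply: (ca_lim hJ) => // e /hl [f [Jf _ _ _] hf]; by exists f.
    + by apply: (comm_lim (D := D)) => // f [].
    + move=> y; apply/ler_addgt0Pr => e e0.
      have y1 : 0 < nrm y + 1 by rewrite ltr_wpDl // nrm_ge0.
      have [f [_ _ _ f1] hf] := hl _ (divr_gt0 e0 y1).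
      have h2 : nrm (l y) <= nrm (f y) + nrm ((f - l) y).
        by rewrite fctE -[l y](subKr (f y)) nrmB.
      apply: le_trans h2 (lerD (f1 y) (le_trans (hf y) _)).
      by rewrite mulrAC ler_pdivrMr // ler_pM2l // lerDl.
  - move=> f g r [_ ff _ f1] [_ gg _ g1] r0 fg.
    rewrite (_ : Phi f - Phi g = 2^-1 *r ((f \o (f - g)) + ((f - g) \o g))).
      have := opbD (opb_comp i2 f1 fg) (opb_comp r0 fg g1).
      by move/(opbZ 2^-1); apply: opb_le; rewrite ger0_norm //; lra.
    apply/funext => y; rewrite /Phi !fctE -scalerBr /=; congr (_ *: _).
    by rewrite opprD addrACA subrr add0r (adj_sub ff) addrA subrK.
  - rewrite subr0; have [_ _ _] := DPhi _ D0; exact.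
exists k; split => // y.
have : k y = 2^-1 *r (h (h y) + k (k y)) by rewrite -{1}hk.
move/(congr1 (fun v => v + v)) ->; rewrite -scalerDl -rmorphD /=.
by rewrite (_ : 2^-1 + 2^-1 = 1) ?rmorph1 ?scale1r ?addrK //; lra.
Qed.

(* [h + i (1 - k)] and [h - i (1 - k)] are isometric, and [h], [1 - k] are
   averages of them. *)
Lemma unitary_trick h k : is_adjoint h h -> is_adjoint k k ->
  k \o h = h \o k -> (forall y, h (h y) = k y + k y - k (k y)) ->
  opb h 1 /\ forall y, nrm (y - h (h y)) <= nrm y.
Proof.
move=> hh kk kh hk.
pose m y := y - k y.
have mm : is_adjoint m m by move=> y z; rewrite /m hipBl hipBr kk.
have hm y : h (m y) = m (h y).
  by rewrite /m (adj_sub hh) -[k (h y)]/((k \o h) y) kh.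
have mmy y : m (m y) = y - h (h y).
  by rewrite /m (adj_sub kk) hk !opprB opprD !addrA [y - k y + _]addrAC.
(* For [c] an imaginary unit the cross terms cancel, as [h] and [m] commute and are self-adjoint;
   what remains is h^2 + m^2 = 1. *)
have iso (c : R[i]) y : c^* = - c -> c * c = -1 -> nrm (h y + c *: m y) = nrm y.
  move=> c1 c2; apply/eqP; rewrite -(@eqrXn2 _ 2) ?nrm_ge0 // -!nrm_hip.
  rewrite !hipDl !hipDr !hipZl !hipZr !hh !mm !hm mmy c1.
  rewrite scalerA mulNr c2 opprK scale1r scaleNr hipBr addrA addrK.
  by rewrite addrC subrK.
pose I : R[i] := 'i.
have I1 : I^* = - I by rewrite conjCi.
have I2 : I * I = -1 by rewrite -expr2 sqrCi.
have I3 : (- I)^* = - - I by rewrite -[in RHS]I1; exact: rmorphN.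
have I4 : - I * - I = -1 by rewrite mulrNN.
have nI : complex.Re `|I| = 1 by rewrite normCi.
have bh y : nrm (h y) <= nrm y.
  have : (h y + I *: m y) + (h y + (- I) *: m y) = h y *+ 2.
    by rewrite addrACA -scalerDl subrr scale0r addr0.
  move/(congr1 (@nrm _ _)); have := nrmD (h y + I *: m y) (h y + (- I) *: m y).
  by rewrite nrmMn !iso // => h1 h2; lra.
have bm y : nrm (m y) <= nrm y.
  have : (h y + I *: m y) - (h y + (- I) *: m y) = (I *: m y) *+ 2.
    by rewrite opprD addrACA subrr add0r scaleNr opprK.
  move/(congr1 (@nrm _ _)); have := nrmB (h y + I *: m y) (h y + (- I) *: m y).
  by rewrite nrmMn nrmZ nI mul1r !iso // => h1 h2; lra.
split=> [y|y]; first by rewrite mul1r.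
by rewrite -mmy (le_trans (bm _)).
Qed.

(* [e] is [h^2 / (h^2 + eps)]. *)
Lemma resolvent_op J h (eps : R) : closed_alg J -> J h -> is_adjoint h h ->
  opb h 2^-1 -> 0 < eps ->
  exists2 e, J e & forall y, eps *r e y = h (h (y - e y)).
Proof.
move=> hJ Jh hh h1 eps0.
have [k [Jk kk kh hk]] := sqrt_op hJ Jh hh h1.
have [_ contr] := unitary_trick hh kk kh hk.
have i2 : 0 <= 2^-1 :> R by rewrite invr_ge0.
pose q := (1 + eps)^-1.
have q1 : (1 + eps) * q = 1 by rewrite mulfV // gt_eqF // addr_gt0.
have q0 : 0 < q by rewrite invr_gt0 addr_gt0.
have q2 : q < 1 by rewrite invf_lt1 ?addr_gt0 // ltrDl.
pose D := [set f | [/\ J f, is_adjoint f f & f \o h = h \o f]].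
(* The equation for [e] reads (1 + eps) e = h^2 + (1 - h^2) e. As 1 - h^2 is contractive by
   [unitary_trick], dividing by 1 + eps gives a contraction that stays in [J]. *)
pose Phi f := q *r ((h \o h) + (f - (h \o h \o f))).
have Jhh : J (h \o h) by exact: (ca_comp hJ).
have [e [Je _ _] he] : exists2 e, D e & Phi e = e.
  apply: (@op_fixpoint _ _ _ D Phi 0 1 q) => //; first exact: ltW.
  - by move=> f [].
  - move=> l ll hl; split => //.
    + apply: (ca_lim hJ) => // e /hl [f [Jf _ _] hf]; by exists f.
    + by apply: (comm_lim (D := D)) => // f [].
  - move=> f [Jf ff fh].
    have fhy z : f (h z) = h (f z) by rewrite -[LHS]/((f \o h) z) fh.
    split.
    + by apply/(ca_scale hJ)/(ca_add hJ)/(ca_sub hJ) => //; apply: (ca_comp hJ).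
    + apply/adj_funZr/adj_funD; first exact: adj_comp.
      apply: adj_funB => // y z /=; by rewrite !hh -fhy -fhy ff.
    + apply/funext => y; rewrite /Phi !fctE (adj_scale hh) (adj_add hh) /=.
      by rewrite (adj_sub hh) !fhy.
  - move=> f g r _ _ r0 fg y.
    rewrite (_ : (Phi f - Phi g) y = q *r ((f - g) y - h (h ((f - g) y)))).
      rewrite nrmZr gtr0_norm // -mulrA ler_wpM2l ?(ltW q0) //.
      exact: le_trans (contr _) (fg y).
    rewrite /Phi !fctE -scalerBr /=; congr (_ *: _).
    by rewrite !(adj_sub hh) opprD addrACA subrr add0r sub_sub_sub.
  - have -> : 0 = 0%:C%C *: h by rewrite scale0r.
    split; [exact: (ca_scale hJ)|exact: adj_funZr|].
    by apply/funext => y; rewrite !fctE (adj_scale hh).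
  - have := opbZ q (opb_comp i2 h1 h1); rewrite subr0 /Phi sub0r.
    rewrite (_ : h \o h \o 0 = 0) ?oppr0 ?addr0; last first.
      by apply/funext => y /=; rewrite !(adj_0 hh).
    by apply: opb_le; rewrite gtr0_norm //; lra.
exists e => // y.
have := congr1 (fun f => (1 + eps) *r f y) he.
rewrite /Phi fctE scalerA -rmorphM q1 scale1r !fctE /= rmorphD rmorph1.
rewrite scalerDl scale1r !(adj_sub hh) addrCA.
by move/addrI => <-.
Qed.

End FunctionalCalculus.

Section ApproximateUnits.
Variables (R : realType) (A : cstarAlg R) (Y Z : hilbMod A).

(** With [h] a small multiple of a' a and r = y - e y, the resolvent equation makes h^2 r of order
    eps. Cauchy-Schwarz passes from h^2 r to h r, and from h r to a r, each time at the cost of a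
    square root. *)
Lemma approx_unit_op (J : set (Y -> Y)) (a : Y -> Z) (a' : Z -> Y) (M eta : R) :
  closed_alg J -> is_adjoint a a' -> 0 <= M -> opb a M -> J (a' \o a) ->
  0 < eta -> exists2 e, J e & opb (a - (a \o e)) eta.
Proof.
move=> hJ aa' M0 aM Ja eta0.
pose s : R := (4 * M ^+ 2 + 1)^-1.
have s1 : 0 < 4 * M ^+ 2 + 1 by rewrite ltr_wpDl // mulr_ge0 // sqr_ge0.
have s0 : 0 < s by rewrite invr_gt0.
pose h := s *r (a' \o a).
have hh : is_adjoint h h by apply/adj_funZr/adj_comp => //; exact: adj_sym.
have h1 : opb h 2^-1.
  have M2 : 0 <= 2 * M by rewrite mulr_ge0.
  have := opbZ s (opb_comp M2 (adj_opb aa' M0 aM) aM); apply: opb_le.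
  rewrite gtr0_norm // /s mulrC ler_pdivrMr //; lra.
have Jh : J h by exact: (ca_scale hJ).
(* The two square roots account for the fourth power of [eta]; the estimates below end in s^2 |a
   r|^4 <= 16 eps |y|^4. *)
pose eps := s ^+ 2 * eta ^+ 4 / 16.
have eps0 : 0 < eps by rewrite divr_gt0 // mulr_gt0 // exprn_gt0.
have [k [_ kk kh hk]] := sqrt_op hJ Jh hh h1.
have [_ contr] := unitary_trick hh kk kh hk.
have [e Je he] := resolvent_op hJ Jh hh h1 eps0.
exists e => // y; set r := y - e y.
rewrite (_ : (a - (a \o e)) y = a r); last by rewrite /r (adj_sub aa').
have hhr : h (h r) = eps *r e y by rewrite he.
have r1 : nrm r <= nrm y.
  have e1 : 0 < 1 + eps by rewrite addr_gt0.
  have : (1 + eps) *r r = eps *r y + (r - h (h r)).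
    by rewrite hhr rmorphD rmorph1 scalerDl scale1r addrCA -scalerBr.
  move/(congr1 (@nrm _ _)); rewrite nrmZr gtr0_norm // => h2.
  have := nrmD (eps *r y) (r - h (h r)); rewrite -h2 nrmZr gtr0_norm //.
  have := contr r; rewrite -[nrm r <= _](ler_pM2l eps0); lra.
have r2 : nrm (h (h r)) <= eps * (2 * nrm y).
  rewrite hhr nrmZr gtr0_norm // ler_pM2l //.
  by rewrite -[e y](subKr y) (le_trans (nrmB _ _)) // -/r; lra.
have y0 := nrm_ge0 y; have nr0 := nrm_ge0 r.
have r3 : nrm (h r) ^+ 2 <= 4 * eps * nrm y ^+ 2.
  rewrite -nrm_hip hh (le_trans (cauchy_schwarz _ _)) //.
  have := ler_pM nr0 (nrm_ge0 _) r1 r2; lra.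
have r4 : s * nrm (a r) ^+ 2 <= 2 * nrm y * nrm (h r).
  rewrite -nrm_hip aa' -[X in X * _](gtr0_norm s0) -nrmZr -hipZr.
  rewrite (le_trans (cauchy_schwarz _ _)) // -[s *r _]/(h r).
  by have := ler_wpM2r (nrm_ge0 (h r)) r1; lra.
rewrite -(@ler_pXn2r _ 4) ?nnegrE ?mulr_ge0 ?nrm_ge0 ?(ltW eta0) //.
have r5 : (s * nrm (a r) ^+ 2) ^+ 2 <= (2 * nrm y * nrm (h r)) ^+ 2.
  by rewrite lerXn2r ?nnegrE ?mulr_ge0 ?nrm_ge0 ?sqr_ge0 ?(ltW s0).
have r6 : 4 * nrm y ^+ 2 * nrm (h r) ^+ 2 <= 4 * nrm y ^+ 2 * (4 * eps * nrm y ^+ 2).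
  by rewrite ler_wpM2l // mulr_ge0 // sqr_ge0.
rewrite -(ler_pM2l (exprn_gt0 2 s0)).
rewrite (_ : s ^+ 2 * nrm (a r) ^+ 4 = (s * nrm (a r) ^+ 2) ^+ 2); last ring.
apply: le_trans r5 _.
rewrite (_ : _ ^+ 2 = 4 * nrm y ^+ 2 * nrm (h r) ^+ 2); last ring.
by apply: le_trans r6 _; rewrite /eps le_eqVlt; apply/orP; left; apply/eqP; field.
Qed.

End ApproximateUnits.

(** * Extension by density, approximate units, automatic continuity *)

Section Extension.
Variable R : realType.

(** Common interface for norm bounds on vectors and for [opb] on plain functions, whose space
    carries no norm. *)
Record seminorm_bound (V : zmodType) (nle : V -> R -> Prop) : Prop := SeminormBound {
  sb_le : forall v r s, r <= s -> nle v r -> nle v s;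
  sb_sub : forall v w r s, nle v r -> nle w s -> nle (v - w) (r + s)
}.

Lemma nrm_seminorm_bound (V : normedModType R[i]) :
  seminorm_bound (fun (v : V) r => nrm v <= r).
Proof.
split=> [v r s rs vr|v w r s vr ws]; first exact: le_trans rs.
by rewrite (le_trans (nrmB _ _)) // lerD.
Qed.

Lemma opb_seminorm_bound (V W : normedModType R[i]) :
  seminorm_bound (fun (T : V -> W) r => opb T r).
Proof. by split=> [T r s /opb_le|S T r s]; [exact|exact: opbB]. Qed.

Lemma nrm_lim (V : normedModType R[i]) (v w : V) K :
  (forall e, 0 < e -> nrm (v - w) <= K * e) -> v = w.
Proof.
move=> h; apply/eqP; rewrite -subr_eq0; apply/eqP/nrm_le0P => e e0.
have K0 : 0 < `|K| + 1 by rewrite ltr_wpDl.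
have e1 := divr_gt0 e0 K0; apply: le_trans (h _ e1) _.
rewrite mulrCA ler_piMr ?(ltW e0) // ler_pdivrMr // mul1r.
by rewrite (le_trans (ler_norm _)) // lerDl.
Qed.

(** Extension by continuity for a relation [G]: no function on a dense subspace is assumed, since
    the bound on differences makes approximating pairs of [v] Cauchy in the second component. *)
Lemma rel_extension (V : zmodType) (nle : V -> R -> Prop)
    (W : completeNormedModType R[i]) (G : set (V * W)) (K : R) (v : V) :
  seminorm_bound nle -> 0 <= K ->
  (forall p p', G p -> G p' -> G (p.1 - p'.1, p.2 - p'.2)) ->
  (forall p r, 0 <= r -> G p -> nle p.1 r -> nrm p.2 <= K * r) ->
  (forall e, 0 < e -> exists2 p, G p & nle (v - p.1) e) ->
  exists w, forall e, 0 < e ->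
    exists2 p, G p & nle (v - p.1) e /\ nrm (w - p.2) <= e.
Proof.
move=> hn K0 GB Gbd dense.
have i0 n : 0 < 2^-1 ^+ n :> R by rewrite exprn_gt0 // invr_gt0.
have /choice [p hp] : forall n, exists p, G p /\ nle (v - p.1) (2^-1 ^+ n).
  by move=> n; have [p] := dense _ (i0 n); exists p.
have [|||l hl] := @geom_cvg R W (fun n => (p n).2) (2 * K) 2^-1; [lra|lra| |].
  move=> n; have [G0 h0] := hp n; have [G1 h1] := hp n.+1.
  have h2 := sb_sub hn h0 h1.
  have := Gbd _ _ (addr_ge0 (ltW (i0 n)) (ltW (i0 n.+1))) (GB _ _ G1 G0).
  rewrite (_ : (p n.+1).1 - _ = v - (p n).1 - (v - (p n.+1).1)).
    move=> /(_ h2) /le_trans; apply; rewrite exprS -mulrA mulrCA ler_wpM2l //.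
    by have := i0 n; lra.
  by rewrite opprB [RHS]addrC subrKA.
exists l => e e0.
have h12 : 0 <= 2^-1 :> R by lra.
have h13 : 2^-1 < 1 :> R by lra.
(* The limit is reached at rate 2 K / (1 - 1/2) = 4 K; the extra 1 makes 2^-n itself at most [e]. *)
have [n hn'] := expr_small (4 * K + 1) h12 h13 e0.
have [Gn hpn] := hp n; exists (p n) => //; split.
  by apply: (sb_le hn _ hpn); have := mulr_ge0 K0 (ltW (i0 n)); lra.
rewrite nrmBC (le_trans (hl n)) // (le_trans _ hn') // ler_wpM2r ?(ltW (i0 n)) //.
by rewrite (_ : 1 - 2^-1 = 2^-1) ?invrK; lra.
Qed.

End Extension.

(** * Kets and approximate units *)

Section Kets.
Variables (R : realType) (A : cstarAlg R).

Lemma ket_adj (Z : hilbMod A) (z : Z) :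
  is_adjoint (ket z) (fun w => <| z, w |> : selfMod A).
Proof. by move=> a w; rewrite /ket hipMl. Qed.

Lemma ket_act (Z : hilbMod A) (z : Z) (a : A) : ket (z <* a) = ket z \o ket (Z := selfMod A) a.
Proof. by apply/funext => b; rewrite /ket /= hactM. Qed.

Lemma ketB (Z : hilbMod A) (z w : Z) : ket (z - w) = ket z - ket w.
Proof. by apply/funext => b; rewrite /ket fctE hactBl. Qed.

Lemma ket_opb (Z : hilbMod A) (z : Z) : opb (ket z) (nrm z).
Proof. by move=> a; exact: nrm_act. Qed.

(** Testing the operator on <z, z> produces [nrm z] to the fourth power, from which the bound on [z]
    is recovered. *)
Lemma opb_ket (Z : hilbMod A) (z : Z) (M : R) :
  0 <= M -> opb (ket z) M -> nrm z <= 2 * M.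
Proof.
move=> M0 h; have [->|z0] := eqVneq (nrm z) 0; first by rewrite mulr_ge0.
have zp : 0 < nrm z by rewrite lt_neqAle eq_sym z0 nrm_ge0.
set a := <| z, z |>; have na : nrm a = nrm z ^+ 2 by rewrite nrm_hip.
have h1 : nrm <| z, z <* a |> = nrm z ^+ 4.
  by rewrite hipMr -/a -{1}[a]hip_star nrm_star_mul na -exprM.
have := cauchy_schwarz z (z <* a); rewrite h1 => h2.
have h3 : nrm z * nrm (z <* a) <= nrm z * (M * nrm z ^+ 2).
  by rewrite ler_wpM2l ?nrm_ge0 // -na; exact: h.
rewrite -(ler_pM2l (exprn_gt0 3 zp)) -exprSr (le_trans h2) //.
have -> : nrm z ^+ 3 * (2 * M) = 2 * (nrm z * (M * nrm z ^+ 2)) by ring.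
by rewrite ler_pM2l.
Qed.

Lemma ket_inj (Z : hilbMod A) : injective (@ket R A Z).
Proof.
move=> z w h; apply/eqP; rewrite -subr_eq0; apply/eqP/nrm_le0P => e e0.
have : nrm (z - w) <= 2 * 0.
  by apply: opb_ket => //; rewrite ketB h subrr; apply: opb0.
by rewrite mulr0 => /le_trans; apply; apply: ltW.
Qed.

Lemma ket_lim (Z : hilbMod A) (D : set Z) (l : selfMod A -> Z) :
  (forall z w, D z -> D w -> D (z - w)) ->
  (forall e : R, 0 < e -> exists2 z, D z & opb (l - ket z) e) ->
  exists2 z, l = ket z & forall e : R, 0 < e -> exists2 w, D w & nrm (z - w) <= e.
Proof.
move=> DB hl.
pose G := [set p : (selfMod A -> Z) * Z | p.1 = ket p.2 /\ D p.2].
have [||||z hz] := @rel_extension R _ _ _ G 2 l (opb_seminorm_bound _ _).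
- by [].
- by move=> p q [-> Dp] [-> Dq]; split; [rewrite ketB|exact: DB].
- by move=> p r r0 [-> _]; exact: opb_ket.
- by move=> e /hl [z Dz hz]; exists (ket z, z).
exists z => [|e /hz [p [_ Dp] [_ hp]]]; last by exists p.2.
apply/funext => a; apply: (@nrm_lim _ _ _ _ (2 * nrm a)) => e /hz [p [p1 _] [h1 h2]].
apply: le_trans (nrm_dist _ _ (p.1 a)) _.
have h3 := h1 a; rewrite !fctE in h3; have h4 := nrm_act (p.2 - z) a.
have h5 := ler_wpM2r (nrm_ge0 a) h2; rewrite nrmBC in h5.
by rewrite hactBl in h4; rewrite p1 /ket in h3 *; lra.
Qed.

Record closed_subalg (I : set A) : Prop := ClosedSubalg {
  csa_add : forall a b, I a -> I b -> I (a + b);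
  csa_scale : forall (r : R) a, I a -> I (r *r a);
  csa_mul : forall a b, I a -> I b -> I (a **c b);
  csa_lim : forall a, (forall e : R, 0 < e -> exists2 b, I b & nrm (a - b) <= e) -> I a
}.

(** On [selfMod A] the operator [ket a] is left multiplication by [a]; the functional calculus for
    operators thereby applies to elements of [A], inside a subalgebra such as ker pi. *)
Lemma closed_alg_ket (I : set A) : closed_subalg I ->
  closed_alg [set f | exists2 a, I a & f = ket (Z := selfMod A) a].
Proof.
move=> hI; split=> [_ _ [a Ia ->] [b Ib ->]|r _ [a Ia ->]|_ _ [a Ia ->] [b Ib ->]|l _ hl].
- exists (a + b); first exact: csa_add.
  by apply/funext => c; rewrite fctE /ket hactDl.
- exists (r *r a); first exact: csa_scale.
  by apply/funext => c; rewrite fctE /ket hactZl.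
- by exists (a **c b); [exact: csa_mul|rewrite -ket_act].
- have [||z -> hz] := @ket_lim (selfMod A) I l.
  + move=> a b Ia Ib; rewrite -scaleN1r (_ : -1 = (-1)%:C%C); last by rewrite rmorphN1.
    by apply: (csa_add hI) => //; apply: (csa_scale hI).
  + by move=> e /hl [_ [a Ia ->] ha]; exists a => //; exact: opbC.
  + by exists z => //; exact: (csa_lim hI).
Qed.

Lemma closed_subalgT : closed_subalg setT.
Proof. by []. Qed.

Lemma ket_sa (a : A) : a^# = a <-> is_adjoint (ket (Z := selfMod A) a) (ket (Z := selfMod A) a).
Proof.
split=> [ha b c|h].
  by rewrite /ket /= cstarM ha cmulA.
apply: (@ket_inj (selfMod A)); apply/funext => b; apply: hip_inj => c.
by rewrite -h /ket /= cstarM cmulA.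
Qed.

Lemma sqrt_cstar (a : A) : a^# = a -> nrm a <= 2^-1 ->
  exists c, [/\ c^# = c, c **c a = a **c c & a **c a = c + c - c **c c].
Proof.
move=> ha a1; have hJ := closed_alg_ket closed_subalgT.
have [|||k [[c _ ->] cc ca hc]] := @sqrt_op R A (selfMod A) _ (ket (Z := selfMod A) a) hJ.
- by exists a.
- exact/ket_sa.
- exact: (opb_le a1 (@ket_opb (selfMod A) a)).
exists c; split; first exact/ket_sa.
- by apply: (@ket_inj (selfMod A)); rewrite (ket_act (Z := selfMod A)) ca -ket_act.
- apply: (@ket_inj (selfMod A)); apply/funext => b.
  rewrite /ket hactBl hactDl.
  by have := hc b; rewrite /ket -!hactM.
Qed.

(** The adjoint of [ket z] followed after [ket z] is left multiplication by <z, z>, which lies in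
    the algebra of [I], so [approx_unit_op] finds its unit there. Halving [e] pays for [opb_ket]. *)
Lemma approx_unit_module (I : set A) (Z : hilbMod A) (z : Z) :
  closed_subalg I -> I <| z, z |> ->
  forall e : R, 0 < e -> exists2 c, I c & nrm (z - z <* c) <= e.
Proof.
move=> hI Iz e e0.
have [||f [c Ic ->] hc] := @approx_unit_op R A (selfMod A) Z _ (ket z)
  (fun w => <| z, w |>) (nrm z) (e / 2) (closed_alg_ket hI) (ket_adj z) (nrm_ge0 z) (ket_opb z).
- by exists <| z, z |> => //; apply/funext => b; rewrite /ket /= hipMr.
- by rewrite divr_gt0.
exists c => //; rewrite -ket_act -ketB in hc.
by apply: le_trans (opb_ket (ltW (divr_gt0 e0 (ltr0n R 2))) hc) _; lra.
Qed.

Lemma approx_unit (Z : hilbMod A) (z : Z) (e : R) : 0 < e ->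
  exists c : A, nrm (z - z <* c) <= e.
Proof.
by move=> e0; have [//|c _ hc] := approx_unit_module (z := z) closed_subalgT _ e0; exists c.
Qed.

End Kets.

(** * Automatic continuity *)

Section AutomaticContinuity.
Variables (R : realType) (A B : cstarAlg R).

(** For a small self-adjoint [a] the element [c] of [sqrt_cstar] lies in [A], so its algebraic
    relations are carried by [phi] and [unitary_trick] applies to the images. Scaling and then
    passing to a^# a covers all of [A]. Acting on a module serves both left actions and
    homomorphisms into [B]. *)
Lemma adjointable_rep_bound (Y : hilbMod B) (phi : A -> Y -> Y) :
  (forall a b y, phi (a + b) y = phi a y + phi b y) ->
  (forall (r : R) a y, phi (r *r a) y = r *r phi a y) ->
  (forall a b y, phi (a **c b) y = phi a (phi b y)) ->
  (forall a, is_adjoint (phi a) (phi (a^#))) ->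
  forall a y, nrm (phi a y) <= 2 * nrm a * nrm y.
Proof.
move=> phiD phiZ phiM phi_adj.
have phiB a b y : phi (a - b) y = phi a y - phi b y.
  rewrite -[- b]scaleN1r (_ : -1 = (-1)%:C%C); last by rewrite rmorphN1.
  by rewrite phiD phiZ rmorphN1 scaleN1r.
have small a y : a^# = a -> nrm a <= 2^-1 -> nrm (phi a y) <= nrm y.
  move=> ha a1; have [c [cc ca hc]] := sqrt_cstar ha a1.
  have [||||h _] := @unitary_trick R B Y (phi a) (phi c).
  - by rewrite -{2}ha.
  - by rewrite -{2}cc.
  - by apply/funext => z /=; rewrite -!phiM ca.
  - by move=> z; rewrite -!phiM hc phiB phiD.
  - by have := h y; rewrite mul1r.
have sa a y : a^# = a -> nrm (phi a y) <= 2 * nrm a * nrm y.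
  move=> ha; have [a0|a0] := eqVneq (nrm a) 0.
    have -> : phi a y = 0; last by rewrite nrm0 a0 mulr0 mul0r.
    by rewrite (nrm_eq0 a0) -[0](subrr (0 : A)) phiB subrr.
  have ap : 0 < nrm a by rewrite lt_neqAle eq_sym a0 nrm_ge0.
  pose s : R := (2 * nrm a)^-1; have s0 : 0 < s by rewrite invr_gt0 mulr_gt0.
  have := small (s *r a) y; rewrite cstarZr ha nrmZr gtr0_norm // phiZ nrmZr.
  rewrite gtr0_norm // /s invfM mulfVK // => /(_ erefl (lexx _)).
  by rewrite -invfM mulrC ler_pdivrMr ?mulr_gt0 // mulrC.
move=> a y; rewrite -(@ler_pXn2r _ 2) ?nnegrE ?mulr_ge0 ?nrm_ge0 //.
rewrite -nrm_hip phi_adj -phiM (le_trans (cauchy_schwarz _ _)) //.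
have := sa (a^# **c a) y; rewrite cstarM cstarK nrm_star_mul => /(_ erefl).
by move/(ler_wpM2l (nrm_ge0 y)); lra.
Qed.

Lemma starhom_bound (f : A -> B) : starhom f -> forall a, nrm (f a) <= 2 * nrm a.
Proof.
move=> [fD fZ fM fs] a.
have h := @adjointable_rep_bound (selfMod B) (fun a b => f a **c b).
have {h} := h _ _ _ _ a (f a)^#.
rewrite -{1}[f a]cstarK nrm_star_mul nrm_star.
move=> h; apply: sqr_le_mul; rewrite ?mulr_ge0 ?nrm_ge0 //; apply: h.
- by move=> b c d; rewrite fD cmulDl.
- by move=> r b c; rewrite fZ cmulZl.
- by move=> b c d; rewrite fM cmulA.
- by move=> b c d /=; rewrite cstarM fs cmulA.
Qed.

End AutomaticContinuity.

Lemma lact_bound (R : realType) (A : cstarAlg R) (X : corr A) a (x : X) :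
  nrm (lact a x) <= 2 * nrm a * nrm x.
Proof.
apply: adjointable_rep_bound => [b c y|r b y|b c y|b].
- exact: lactDl.
- exact: lactZl.
- exact: lactM.
- exact: lact_adj.
Qed.

(** * Compact operators *)

Section CompactOperators.
Variables (R : realType) (A : cstarAlg R).
Implicit Types Y Z W : hilbMod A.

(** Coefficients of a linear combination are absorbed into the first entries, so finite rank
    operators are lists and their sum is concatenation. *)
Definition thetas Y Z (s : seq (Z * Y)) : Y -> Z :=
  \sum_(p <- s) theta p.1 p.2.

Lemma thetas_nil Y Z : thetas [::] = 0 :> (Y -> Z).
Proof. exact: big_nil. Qed.

Lemma thetas_cons Y Z p (s : seq (Z * Y)) :
  thetas (p :: s) = theta p.1 p.2 + thetas s.
Proof. exact: big_cons. Qed.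

Lemma thetas_cat Y Z (s s' : seq (Z * Y)) :
  thetas (s ++ s') = thetas s + thetas s'.
Proof. exact: big_cat. Qed.

Lemma thetasE Y Z (s : seq (Z * Y)) w :
  thetas s w = \sum_(p <- s) p.1 <* <| p.2, w |>.
Proof. by rewrite /thetas fct_sumE. Qed.

Lemma thetaZ Y Z (z : Z) (y : Y) (k : R[i]) : theta (k *: z) y = k *: theta z y.
Proof. by apply/funext => w; rewrite fctE /theta hactZl. Qed.

Lemma compact_intoP Y Z (D : set Z) (T : Y -> Z) :
  (forall (k : R[i]) z, D z -> D (k *: z)) ->
  compact_into D T <-> adjointable T /\ forall e : R, 0 < e ->
    exists2 s : seq (Z * Y), (forall p, p \in s -> D p.1) & opb (T - thetas s) e.
Proof.
move=> DZ; split=> -[aT hT]; split=> // e e0.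
  have [|F [n [c [f [hf ->]]]] /opnorm_leE hF] := hT e%:C%C; first by rewrite ltcR.
  have /choice [g hg] : forall i, exists p : Z * Y, D p.1 /\ f i = theta p.1 p.2.
    by move=> i; have [z [y [Dz ->]]] := hf i; exists (z, y).
  exists [seq (c i *: (g i).1, (g i).2) | i <- enum 'I_n].
    by move=> p /mapP [i _ ->] /=; apply: DZ; have [] := hg i.
  rewrite (_ : thetas _ = \sum_(i < n) c i *: f i) //.
  rewrite /thetas big_map big_enum /=; apply: eq_bigr => i _.
  by rewrite thetaZ; have [_ ->] := hg i.
have e1 : 0 < complex.Re e by rewrite -ltcR -ReK // ltW.
have [s sD hs] := hT _ e1; exists (thetas s); last first.
  by rewrite [e]ReK ?ltW //; apply/opnorm_leE.
pose g i := nth (0, 0) s i.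
exists (size s), (fun=> 1), (fun i => theta (g i).1 (g i).2); split=> [i|].
  by exists (g i).1, (g i).2; split => //; apply/sD/mem_nth.
rewrite /thetas (big_nth (0, 0)) big_mkord; apply: eq_bigr => i _.
by rewrite scale1r.
Qed.

Lemma compactP Y Z (T : Y -> Z) : compact_op T <-> adjointable T /\
  forall e : R, 0 < e -> exists s : seq (Z * Y), opb (T - thetas s) e.
Proof.
split=> [/compact_intoP[//|aT hT]|[aT hT]].
  by split=> // e /hT [s _ hs]; exists s.
by apply/compact_intoP => //; split=> // e /hT [s hs]; exists s.
Qed.

Lemma theta_adj Y Z (z : Z) (y : Y) : is_adjoint (theta z y) (theta y z).
Proof. by move=> w v; rewrite /theta hipMl hipMr hip_star. Qed.

Lemma thetas_adj Y Z (s : seq (Z * Y)) :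
  is_adjoint (thetas s) (thetas [seq (p.2, p.1) | p <- s]).
Proof.
elim: s => [|p s IH] /=.
  by rewrite !thetas_nil => y z; rewrite [LHS]hip0l [RHS]hip0r.
by rewrite !thetas_cons; apply: adj_funD => //; exact: theta_adj.
Qed.

Lemma theta_opb Y Z (z : Z) (y : Y) : opb (theta z y) (2 * nrm z * nrm y).
Proof.
move=> w; rewrite (le_trans (nrm_act _ _)) //.
by have := ler_wpM2l (nrm_ge0 z) (cauchy_schwarz y w); lra.
Qed.

Lemma thetas_opb Y Z (s : seq (Z * Y)) : exists2 M, 0 <= M & opb (thetas s) M.
Proof.
elim: s => [|p s [M M0 hM]]; first by exists 0 => //; rewrite thetas_nil; exact: opb0.
exists (2 * nrm p.1 * nrm p.2 + M); first by rewrite addr_ge0 ?mulr_ge0 ?nrm_ge0.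
by rewrite thetas_cons; apply: opbD => //; exact: theta_opb.
Qed.

Lemma compact_opb Y Z (T : Y -> Z) : compact_op T -> exists2 M, 0 <= M & opb T M.
Proof.
move=> /compactP [_ /(_ _ ltr01) [s hs]]; have [M M0 hM] := thetas_opb s.
exists (1 + M); first exact: addr_ge0.
by rewrite -[T](subrK (thetas s)); apply: opbD.
Qed.

Lemma compact_adjointable Y Z (T : Y -> Z) : compact_op T -> adjointable T.
Proof. by case/compactP. Qed.

Lemma compact_theta Y Z (z : Z) (y : Y) : compact_op (theta z y).
Proof.
apply/compactP; split; first by exists (theta y z); exact: theta_adj.
move=> e e0; exists [:: (z, y)]; rewrite thetas_cons thetas_nil addr0 subrr.
by apply: opb0; exact: ltW.
Qed.

Lemma compact_adj Y Z (T : Y -> Z) (S : Z -> Y) :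
  compact_op T -> is_adjoint T S -> compact_op S.
Proof.
move=> /compactP [_ hT] TS; apply/compactP; split; first by exists T; exact: adj_sym.
move=> e e0; have e2 : 0 < e / 2 by rewrite divr_gt0.
have [s hs] := hT _ e2; exists [seq (p.2, p.1) | p <- s].
have := adj_opb (adj_funB TS (thetas_adj s)) (ltW e2) hs.
by apply: opb_le; lra.
Qed.

Lemma compactD Y Z (T S : Y -> Z) : compact_op T -> compact_op S -> compact_op (T + S).
Proof.
move=> /compactP [[T' TT'] hT] /compactP [[S' SS'] hS]; apply/compactP; split.
  by exists (T' + S'); exact: adj_funD.
move=> e e0; have e2 : 0 < e / 2 by rewrite divr_gt0.
have [s hs] := hT _ e2; have [s' hs'] := hS _ e2; exists (s ++ s').
by rewrite thetas_cat opprD addrACA; apply: opb_le (opbD hs hs'); lra.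
Qed.

Lemma compact_comp Y Z W (T : Z -> W) (S : Y -> Z) (S' : Z -> Y) (M : R) :
  compact_op T -> is_adjoint S S' -> 0 <= M -> opb S M -> compact_op (T \o S).
Proof.
move=> /compactP [[T' TT'] hT] SS' M0 hM; apply/compactP; split.
  by exists (S' \o T'); exact: adj_comp.
move=> e e0; have M1 : 0 < M + 1 by rewrite ltr_wpDl.
have e2 : 0 < e / (M + 1) by rewrite divr_gt0.
have [s hs] := hT _ e2; exists [seq (p.1, S' p.2) | p <- s].
rewrite (_ : _ - _ = (T - thetas s) \o S); last first.
  apply/funext => y; rewrite !fctE /= !thetasE big_map; congr (_ - _).
  by apply: eq_bigr => p _; rewrite -(adj_sym SS').
apply: opb_le (opb_comp (ltW e2) hs hM).
by rewrite mulrAC ler_pdivrMr // ler_pM2l // lerDl.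
Qed.

Lemma compact_lim Y Z (T : Y -> Z) : adjointable T ->
  (forall e : R, 0 < e -> exists2 S, compact_op S & opb (S - T) e) -> compact_op T.
Proof.
move=> aT hT; apply/compactP; split=> // e e0.
have e2 : 0 < e / 2 by rewrite divr_gt0.
have [S /compactP [_ hS] ST] := hT _ e2; have [s hs] := hS _ e2; exists s.
by apply: opb_le (opb_dist (opbC ST) hs); lra.
Qed.

Lemma closed_alg_compact Y : closed_alg [set T : Y -> Y | compact_op T].
Proof.
split=> [f g|r f|f g|l ll hl] /=; first exact: compactD.
- move=> cf; have [f' ff'] := compact_adjointable cf.
  have rr : is_adjoint (fun y : Y => r *r y) (fun y => r *r y).
    by move=> y z; rewrite hipZlr hipZr.
  rewrite (_ : r *r f = f \o (fun y => r *r y)); last first.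
    by apply/funext => y; rewrite !fctE /= (adj_scale ff').
  by apply: (compact_comp (M := `|r|) cf rr) => // y; rewrite nrmZr.
- move=> cf cg; have [g' gg'] := compact_adjointable cg.
  by have [M M0 hM] := compact_opb cg; exact: compact_comp hM.
- by apply: compact_lim => //; exists l.
Qed.

Lemma compact_approx_unit Y Z (T : Y -> Z) (e : R) : compact_op T -> 0 < e ->
  exists2 u : Y -> Y, compact_op u & opb (T - (T \o u)) e.
Proof.
move=> cT e0; have [T' TT'] := compact_adjointable cT.
have [M M0 hM] := compact_opb cT.
apply: (approx_unit_op (closed_alg_compact Y) TT' M0 hM) => //=.
exact: (compact_comp (compact_adj cT TT') TT' M0 hM).
Qed.

(** Without a unit, [ket z] need not be a [theta]; but [ket (z <* c)] is one, and z <* c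
    approximates [z]. *)
Lemma compact_ket Z (z : Z) : compact_op (ket z).
Proof.
apply: compact_lim; first by eexists; exact: ket_adj.
move=> e e0; have [c hc] := approx_unit z e0; exists (theta z (c^# : selfMod A)).
  exact: compact_theta.
rewrite (_ : theta _ _ = ket (z <* c)); last first.
  by apply/funext => b; rewrite /theta /ket /= cstarK hactM.
by rewrite -ketB; apply: opb_le (ket_opb _); rewrite nrmBC.
Qed.

Lemma compact_ketP Z (T : selfMod A -> Z) : compact_op T -> exists z, T = ket z.
Proof.
move=> /compactP [_ hT]; have [//|e e0|z -> _] := @ket_lim R A Z setT T.
  have [s hs] := hT _ e0; exists (\sum_(p <- s) p.1 <* (p.2 : A)^#) => //.
  rewrite (_ : ket _ = thetas s) //; apply/funext => b; rewrite thetasE /ket.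
  rewrite (big_morph (fun z : Z => z <* b) (fun x y => hactDl x y b) (hact0l _ b)).
  by apply: eq_bigr => p _ /=; rewrite -hactM.
by exists z.
Qed.

End CompactOperators.

(** * Bounds from the growth of powers *)

(** Taking 2^n-th roots removes [M]: if L < x, the powers of L / x would tend to 0 and contradict
    the hypothesis. *)
Lemma pow2_bound (R : realType) (x L M : R) : 0 <= x -> 0 <= L ->
  (forall n, x ^+ (2 ^ n) <= M * L ^+ (2 ^ n)) -> x <= L.
Proof.
move=> x0 L0 h; rewrite leNgt; apply/negP => Lx.
have xp : 0 < x := le_lt_trans L0 Lx.
have q0 : 0 <= L / x by rewrite divr_ge0.
have q1 : L / x < 1 by rewrite ltr_pdivrMr // mul1r.
have h2 : 0 < 2^-1 :> R by rewrite invr_gt0.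
have hq n : 1 <= M * (L / x) ^+ (2 ^ n).
  by rewrite expr_div_n mulrA ler_pdivlMr ?exprn_gt0 // mul1r.
have M0 : 0 <= M.
  rewrite leNgt; apply/negP => M0; have := hq 0; rewrite expr1 => h1.
  by have := mulr_le0_ge0 (ltW M0) q0; lra.
have [n hn] := expr_small M q0 q1 h2; have := hq n.
have : M * (L / x) ^+ (2 ^ n) <= M * (L / x) ^+ n.
  by rewrite ler_wpM2l // ler_wiXn2l // ?(ltW q1) // ltnW // ltn_expl.
lra.
Qed.

(* If [z j = S^j (z 0)] with [S] self-adjoint, this bounds [S] at [z 0] by any
   exponential growth rate of its powers there, without assuming that [S] is
   well defined. *)
Lemma hankel_bound (R : realType) (A : cstarAlg R) (W : hilbMod A) (z : nat -> W)
    (M L : R) : 0 <= L ->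
  (forall i j, <| z i.+1, z j |> = <| z i, z j.+1 |>) ->
  (forall j, nrm (z j) <= M * L ^+ j) -> nrm (z 1) <= 2 * L * nrm (z 0).
Proof.
move=> L0 hz hM.
have shift i j : <| z i, z j |> = <| z 0, z (i + j)%N |>.
  by elim: i j => // i IH j; rewrite hz IH addnS.
have step n : nrm (z n) ^+ 2 <= 2 * nrm (z 0) * nrm (z (n + n)%N).
  by rewrite -nrm_hip shift -mulrA cauchy_schwarz.
have [z0|z0] := eqVneq (nrm (z 0)) 0.
  rewrite z0 mulr0; apply: sqr_le_mul; rewrite ?nrm_ge0 // mul0r.
  by have := step 1; rewrite z0 mulr0 mul0r.
have c0 : 0 < 2 * nrm (z 0) by rewrite mulr_gt0 // lt_neqAle eq_sym z0 nrm_ge0.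
(* Dividing by 2 |z 0| absorbs the constant of [cauchy_schwarz], so squaring [d n] gives at most
   [d n.+1], with no constant left to accumulate. *)
pose d n := nrm (z (2 ^ n)%N) / (2 * nrm (z 0)).
have d0 n : 0 <= d n by rewrite divr_ge0 ?nrm_ge0 // ltW.
have dS n : d n ^+ 2 <= d n.+1.
  have := step (2 ^ n)%N; rewrite addnn -mul2n -expnS => h.
  rewrite /d; set k := 2 * _ in c0 h *.
  have k0 : k != 0 by rewrite gt_eqF.
  rewrite ler_pdivlMr // (_ : (_ / k) ^+ 2 * k = nrm (z (2 ^ n)%N) ^+ 2 / k); last by field.
  by rewrite ler_pdivrMr // mulrC.
have dn n : d 0 ^+ (2 ^ n) <= d n.
  elim: n => [|n IH]; first by rewrite expn0 expr1.
  rewrite expnSr exprM (le_trans _ (dS n)) // lerXn2r // nnegrE // exprn_ge0 //.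
rewrite mulrAC -ler_pdivrMl // mulrC; apply: (@pow2_bound _ _ _ (M / (2 * nrm (z 0)))) => //.
  exact: (d0 0).
move=> n; apply: le_trans (dn n) _.
by rewrite /d mulrAC ler_pM2r ?invr_gt0.
Qed.

(** * Interior tensor products and right tensoring *)

Lemma nrm_sum (R : realType) (V : normedModType R[i]) (I : Type) (s : seq I) (F : I -> V) :
  nrm (\sum_(i <- s) F i) <= \sum_(i <- s) nrm (F i).
Proof.
elim: s => [|i s IH]; first by rewrite !big_nil nrm0.
by rewrite !big_cons (le_trans (nrmD _ _)) // lerD.
Qed.

Lemma morph_add0 (V W : zmodType) (f : V -> W) : {morph f : u v / u + v} -> f 0 = 0.
Proof. by move=> fD; apply: (addrI (f 0)); rewrite -fD !addr0. Qed.

Section InteriorTensor.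
Variables (R : realType) (A : cstarAlg R) (X : corr A) (Y Z : hilbMod A).
Variables (tau : Y -> X -> Z).
Hypothesis hit : interior_tensor tau.

Lemma it_Nl y x : tau (- y) x = - tau y x.
Proof. by rewrite -scaleN1r (itZl hit) scaleN1r. Qed.

Lemma it_approx (z : Z) (e : R) : 0 < e ->
  exists s : seq (Y * X), nrm (z - \sum_(p <- s) tau p.1 p.2) <= e.
Proof.
move=> e0; have : closure (cspan [set z | exists y x, z = tau y x]) z.
  by rewrite (it_dense hit).
have e1 : 0 < e%:C%C by rewrite ltcR.
move/(_ _ (nbhsx_ballx z _ e1)) => [w [[n [c [f [hf ->]]]]]].
rewrite -ball_normE /= normE ltcR => /ltW hw.
have /choice [g hg] : forall i, exists p : Y * X, f i = tau p.1 p.2.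
  by move=> i; have [y [x ->]] := hf i; exists (y, x).
exists [seq (c i *: (g i).1, (g i).2) | i <- enum 'I_n].
rewrite big_map big_enum /= (eq_bigr (fun i => c i *: f i)) // => i _.
by rewrite (itZl hit) hg.
Qed.

Lemma it_hip (V V' : Type) (f : V -> Y) (g : V' -> Y) (s : seq (V * X)) (s' : seq (V' * X)) :
  <| \sum_(p <- s) tau (f p.1) p.2, \sum_(p <- s') tau (g p.1) p.2 |> =
  \sum_(p <- s) \sum_(q <- s') <| p.2, lact <| f p.1, g q.1 |> q.2 |>.
Proof.
rewrite hip_suml; apply: eq_bigr => p _; rewrite hip_sumr.
by apply: eq_bigr => q _; rewrite (it_ip hit).
Qed.

Lemma it_bound y x : nrm (tau y x) <= 2 * nrm y * nrm x.
Proof.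
rewrite -(@ler_pXn2r _ 2) ?nnegrE ?mulr_ge0 ?nrm_ge0 //.
rewrite -nrm_hip (it_ip hit) (le_trans (cauchy_schwarz _ _)) //.
have := lact_bound <| y, y |> x; rewrite nrm_hip.
by move/(ler_wpM2l (nrm_ge0 x)); lra.
Qed.

Lemma it_eq0 (W : normedModType R[i]) (D : Z -> W) (K : R) :
  0 <= K -> {morph D : u v / u + v} -> opb D K ->
  (forall y x, D (tau y x) = 0) -> forall z, D z = 0.
Proof.
move=> K0 DD DK D0 z; apply: (@nrm_lim _ _ _ _ K) => e /(it_approx z) [s hs].
rewrite subr0 -[z](subrK (\sum_(p <- s) tau p.1 p.2)) DD.
rewrite [X in _ + X](big_morph _ DD (morph_add0 DD)).
rewrite [X in _ + X]big1 => [|p _]; last exact: D0.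
by rewrite addr0 (le_trans (DK _)) // ler_wpM2l.
Qed.

Lemma it_inj (u v : Z) : (forall y x, <| u, tau y x |> = <| v, tau y x |>) -> u = v.
Proof.
move=> h; apply/eqP; rewrite -subr_eq0; apply/eqP/hip_eq0.
apply: (@it_eq0 _ (fun z => <| u - v, z |>) (2 * nrm (u - v))).
- by rewrite mulr_ge0 // nrm_ge0.
- exact: hipDr.
- by move=> z; rewrite -mulrA cauchy_schwarz.
- by move=> y x; rewrite hipBl h subrr.
Qed.

(** An adjoint need only be found on simple tensors: by Cauchy-Schwarz it is bounded by 2 M wherever
    it exists, so [rel_extension] carries it to all of [Z]. *)
Lemma it_adjointable (W : hilbMod A) (q : W -> Z) (M : R) : 0 <= M -> opb q M ->
  (forall y x, exists w, forall v, <| tau y x, q v |> = <| w, v |>) -> adjointable q.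
Proof.
move=> M0 hM hq.
pose G := [set p : Z * W | forall v, <| p.1, q v |> = <| p.2, v |>].
have /choice [p hp] : forall z, exists w, G (z, w).
  move=> z.
  have [|||||w hw] := @rel_extension R Z (fun z r => nrm z <= r) W G (2 * M) z.
  - exact: nrm_seminorm_bound.
  - by rewrite mulr_ge0.
  - by move=> p p' Gp Gp' v /=; rewrite !hipBl Gp Gp'.
  - move=> [z' w] r r0 Gzw /= zr; apply: sqr_le_mul; rewrite ?mulr_ge0 ?nrm_ge0 //.
    rewrite -nrm_hip -Gzw (le_trans (cauchy_schwarz _ _)) //=.
    have := ler_pM (nrm_ge0 z') (nrm_ge0 (q w)) zr (hM w); lra.
  - move=> e /(it_approx z) [s hs].
    have /choice [g hg] : forall p : Y * X, exists w, forall v, <| tau p.1 p.2, q v |> = <| w, v |>.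
      by move=> p; exact: hq.
    exists (\sum_(p <- s) tau p.1 p.2, \sum_(p <- s) g p) => //= v.
    by rewrite !hip_suml; apply: eq_bigr => p _.
  exists w => v; apply: (@nrm_lim _ _ _ _ (2 * M * nrm v + 2 * nrm v)) => e /hw [p Gp [h1 h2]].
  rewrite (_ : _ - _ = <| z - p.1, q v |> - <| w - p.2, v |>); last first.
    by rewrite !hipBl Gp opprB addrA subrK.
  rewrite (le_trans (nrmB _ _)) //.
  have h3 := cauchy_schwarz (z - p.1) (q v); have h4 := cauchy_schwarz (w - p.2) v.
  have h5 := ler_pM (nrm_ge0 _) (nrm_ge0 _) h1 (hM v).
  have h6 := ler_wpM2r (nrm_ge0 v) h2; lra.
by exists p; apply: adj_sym => z w; rewrite -hp.
Qed.

Lemma creation_adjointable (y : Y) : adjointable (tau y : X -> Z).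
Proof.
apply: (@it_adjointable _ _ (2 * nrm y)); first by rewrite mulr_ge0 // nrm_ge0.
  exact: it_bound.
move=> y' x; exists (lact <| y, y' |> x) => v.
by rewrite (it_ip hit) lact_adj hip_star.
Qed.

End InteriorTensor.

Section TensorOperator.
Variables (R : realType) (A : cstarAlg R) (X : corr A) (Y Z Y' Z' : hilbMod A).
Variables (tau : Y -> X -> Z) (tau' : Y' -> X -> Z').
Hypotheses (hit : interior_tensor tau) (hit' : interior_tensor tau').

(** The vectors [z j] are the formal images of the sum under (S T)^j (x) 1. Self-adjointness of S T
    gives the symmetry that [hankel_bound] asks for, and the growth rate is 2 M^2. The final
    estimate is 8 M^2 <= 9 M^2, whence the factor 3. *)
Lemma tensor_sum_bound (T : Y -> Y') (S : Y' -> Y) (M : R) (s : seq (Y * X)) :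
  is_adjoint T S -> 0 <= M -> opb T M ->
  nrm (\sum_(p <- s) tau' (T p.1) p.2) <= 3 * M * nrm (\sum_(p <- s) tau p.1 p.2).
Proof.
move=> TS M0 hM; pose f j (y : Y) := iter j (S \o T) y.
pose z j := \sum_(p <- s) tau (f j p.1) p.2; pose L := 2 * M ^+ 2.
have L0 : 0 <= L by rewrite mulr_ge0 // sqr_ge0.
have SL : opb (S \o T) L.
  have M2 : 0 <= 2 * M by rewrite mulr_ge0.
  by have := opb_comp M2 (adj_opb TS M0 hM) hM; apply: opb_le; rewrite /L; lra.
have z1 : nrm (z 1) <= 2 * L * nrm (z 0).
  apply: (@hankel_bound _ _ _ _ (\sum_(p <- s) (2 * nrm p.1 * nrm p.2))) => // [i j|j].
    rewrite /z !(it_hip hit); apply: eq_bigr => p _; apply: eq_bigr => q _.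
    congr (<| _, lact _ _ |>); rewrite /f !iterS /=.
    by rewrite (adj_sym TS) TS.
  rewrite (le_trans (nrm_sum _ _)) // mulr_suml ler_sum // => p _.
  rewrite (le_trans (it_bound hit _ _)) // [leRHS]mulrAC ler_wpM2r ?nrm_ge0 //.
  rewrite -mulrA ler_wpM2l //.
  elim: j => [|j IH]; first by rewrite mulr1.
  rewrite /f iterS (le_trans (SL _)) // exprS mulrCA.
  by rewrite ler_wpM2l.
rewrite -(@ler_pXn2r _ 2) ?nnegrE ?mulr_ge0 ?nrm_ge0 //.
rewrite -nrm_hip (it_hip hit').
rewrite (_ : \sum_(p <- s) _ = <| z 0, z 1 |>); last first.
  rewrite (it_hip hit); apply: eq_bigr => p _; apply: eq_bigr => q _.
  by rewrite TS.
rewrite (le_trans (cauchy_schwarz _ _)) // -/(z 0).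
have := ler_wpM2l (nrm_ge0 (z 0)) z1; rewrite /L => h.
have := mulr_ge0 (sqr_ge0 M) (sqr_ge0 (nrm (z 0))); lra.
Qed.

Lemma tensor_op (T : Y -> Y') (S : Y' -> Y) (M : R) :
  is_adjoint T S -> 0 <= M -> opb T M ->
  exists b : Z -> Z', [/\ adjointable b, exists2 K, 0 <= K & opb b K &
    forall y x, b (tau y x) = tau' (T y) x].
Proof.
move=> TS M0 hM.
pose G := [set p : Z * Z' | exists s : seq (Y * X),
  p = (\sum_(p <- s) tau p.1 p.2, \sum_(p <- s) tau' (T p.1) p.2)].
have K0 : 0 <= 3 * M by rewrite mulr_ge0.
(* Values are chosen point by point, without linearity; it follows once [b] is shown to have an
   adjoint. *)
have /choice [b hb] : forall z, exists w, forall e, 0 < e ->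
    exists2 p, G p & nrm (z - p.1) <= e /\ nrm (w - p.2) <= e.
  move=> z; apply: (@rel_extension R Z (fun z r => nrm z <= r) Z' G (3 * M) z) => //.
  - exact: nrm_seminorm_bound.
  - move=> _ _ [s ->] [s' ->]; exists (s ++ [seq (- p.1, p.2) | p <- s']) => /=.
    rewrite !big_cat !big_map /=; congr (_ + _, _ + _); rewrite -sumrN.
      by apply: eq_bigr => p _; rewrite (it_Nl hit).
    by apply: eq_bigr => p _; rewrite (adj_opp TS) (it_Nl hit').
  - move=> _ r r0 [s ->] /= hr; apply: le_trans (tensor_sum_bound s TS M0 hM) _.
    exact: ler_wpM2l.
  - by move=> e /(it_approx hit z) [s hs]; eexists; first by exists s.
have bK : opb b (3 * M).
  move=> z; apply/ler_addgt0Pr => e e0.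
  have k0 : 0 < 3 * M + 1 by rewrite ltr_wpDl.
  have [_ [s ->] /= [h1 h2]] := hb z _ (divr_gt0 e0 k0).
  have h3 := tensor_sum_bound s TS M0 hM.
  set u := \sum_(p <- s) tau p.1 p.2 in h1 h3; set v := \sum_(p <- s) _ in h2 h3.
  have h4 := nrmD (b z - v) v; rewrite subrK in h4.
  have h5 : nrm u <= nrm z + nrm (z - u) by rewrite -{1}[u](subKr z) nrmB.
  have h6 := ler_wpM2l K0 (le_trans h5 (lerD (lexx _) h1)).
  apply: le_trans h4 _; apply: le_trans (lerD h2 (le_trans h3 h6)) _.
  by rewrite le_eqVlt; apply/orP; left; apply/eqP; field; rewrite gt_eqF.
have badj z y x : <| tau' y x, b z |> = <| tau (S y) x, z |>.
  apply: (@nrm_lim _ _ _ _ (2 * nrm (tau' y x) + 2 * nrm (tau (S y) x))) => e.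
  move=> /(hb z) [_ [s ->] /= [h1 h2]].
  set u := \sum_(p <- s) tau p.1 p.2 in h1; set v := \sum_(p <- s) _ in h2.
  have uv : <| tau' y x, v |> = <| tau (S y) x, u |>.
    rewrite !hip_sumr; apply: eq_bigr => p _.
    by rewrite (it_ip hit) (it_ip hit') -(adj_sym TS).
  rewrite (_ : _ - _ = <| tau' y x, b z - v |> - <| tau (S y) x, z - u |>); last first.
    by rewrite !hipBr uv opprB addrA subrK.
  rewrite (le_trans (nrmB _ _)) //.
  have h3 := cauchy_schwarz (tau' y x) (b z - v).
  have h4 := cauchy_schwarz (tau (S y) x) (z - u).
  have h5 := ler_wpM2l (nrm_ge0 (tau' y x)) h2.
  have h6 := ler_wpM2l (nrm_ge0 (tau (S y) x)) h1; lra.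
exists b; split; last 1 first.
- move=> y x; apply: (it_inj hit') => y' x'.
  rewrite -[LHS]hip_star badj hip_star (it_ip hit) (it_ip hit').
  by rewrite TS.
- apply: (it_adjointable hit' K0 bK) => y x; exists (tau (S y) x) => v.
  exact: badj.
- by exists (3 * M).
Qed.

End TensorOperator.

(** * Right tensoring *)

Section RightTensoring.
Variables (R : realType) (A : cstarAlg R) (X : corr A) (P : tensorPowers X).

Lemma tens_interior n : interior_tensor (tens (P := P) (n := n.+1)).
Proof. exact: tp_interior. Qed.

Lemma KX_TX n m (a : tpow P m -> tpow P n) : KX P n m a -> TX P n m a.
Proof. by case: n m a => [|n] [|m] a //; exact: compact_adjointable. Qed.

Lemma tens_adjointable n (z : tpow P n) : adjointable (tens z : X -> tpow P n.+1).
Proof.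
case: n z => [|n] z; first by exists (lact (z^# : A)); exact: lact_adj.
exact: (creation_adjointable (tens_interior n)).
Qed.

Lemma tens_opb n (z : tpow P n) : opb (tens z : X -> tpow P n.+1) (2 * nrm z).
Proof.
case: n z => [|n] z x; first exact: (@lact_bound _ _ X).
exact: (it_bound (tens_interior n)).
Qed.

Definition bounded_op (Y Z : hilbMod A) (T : Y -> Z) := exists2 M : R, 0 <= M & opb T M.

(** A ket is tensored to the creation operator [tens z], a bra (n = 0 < m) to the adjoint of that
    operator, and an operator between positive powers is handled by [tensor_op]. *)
Lemma rtens_exists n m (a : tpow P m -> tpow P n) : TX P n m a -> bounded_op a ->
  exists b, [/\ TX P n.+1 m.+1 b, bounded_op b & rtens_spec a b].
Proof.
case: m a => [|m] a.
  move=> Ta _; have [z az] : exists z, a = ket z.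
    by apply: compact_ketP; case: n a Ta.
  exists (tens z); split; first exact: tens_adjointable.
    by exists (2 * nrm z); [rewrite mulr_ge0 // nrm_ge0|exact: tens_opb].
  by exists z.
case: n a => [|n] a Ta [M M0 hM].
  have [S aS] := compact_adjointable Ta.
  have [z Sz] := compact_ketP (compact_adj Ta aS).
  have az y : a y = <| z, y |>.
    apply: (@hip_inj _ _ (selfMod A)) => c; rewrite -(adj_sym aS) Sz.
    exact: hipMl.
  have [p zp] := tens_adjointable z; exists p; split.
  - by exists (tens z); exact: adj_sym.
  - exists (2 * (2 * nrm z)); first by rewrite !mulr_ge0 // nrm_ge0.
    by apply: (adj_opb zp); [rewrite mulr_ge0 // nrm_ge0|exact: tens_opb].
  - move=> y x; apply: hip_inj => w; rewrite -zp (it_ip (tens_interior m)).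
    by rewrite az.
have [S aS] := Ta.
have [b [Tb bb hb]] := tensor_op (tens_interior m) (tens_interior n) aS M0 hM.
by exists b.
Qed.

Lemma rtens_uniq n m (a : tpow P m -> tpow P n) b b' :
  TX P n.+1 m.+1 b -> rtens_spec a b -> TX P n.+1 m.+1 b' -> rtens_spec a b' -> b = b'.
Proof.
case: m a b b' => [|m] a b b'.
  by move=> _ [z -> ->] _ [z' /ket_inj -> ->].
move=> [S bS] hb [S' bS'] hb'; apply/funext => z; apply: hip_inj => w.
rewrite -(adj_sym bS) -(adj_sym bS'); congr (<| _, _ |>).
apply: (it_inj (tens_interior m)) => y x.
by rewrite (adj_sym bS) (adj_sym bS') hb hb'.
Qed.

Lemma rtensP n m (a : tpow P m -> tpow P n) : TX P n m a -> bounded_op a ->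
  [/\ TX P n.+1 m.+1 (rtens a), bounded_op (rtens a) & rtens_spec a (rtens a)].
Proof.
move=> Ta ba; have [b [Tb bb hb]] := rtens_exists Ta ba.
suff -> : rtens a = b by [].
have [] : TX P n.+1 m.+1 (rtens a) /\ rtens_spec a (rtens a).
  exact: (@xgetPex _ (fun=> 0) [set b | TX P n.+1 m.+1 b /\ rtens_spec a b]
    (ex_intro _ b (conj Tb hb))).
by move=> T h; exact: rtens_uniq T h Tb hb.
Qed.

Lemma rtens_ket n (z : tpow P n) : rtens (ket z : tpow P 0 -> tpow P n) = tens z.
Proof.
have cz : KX P n 0 (ket z) := compact_ket z.
by have [_ _ [w /ket_inj -> ->]] := rtensP (KX_TX cz) (compact_opb (cz : compact_op _)).
Qed.

Lemma rtens_iterP k n m (a : tpow P m -> tpow P n) : KX P n m a ->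
  TX P (k + n) (k + m) (rtens_iter P k n m a) /\ bounded_op (rtens_iter P k n m a).
Proof.
move=> Ka; elim: k => [|k [Tk bk]]; first by split; [exact: KX_TX|exact: compact_opb].
by have [] := rtensP Tk bk.
Qed.

End RightTensoring.

(** * Representations *)

Section InnerProductMaps.
Variables (R : realType) (A B : cstarAlg R) (pi : A -> B).
Hypothesis hpi : starhom pi.

(** This single identity implies additivity, homogeneity, A-linearity and boundedness: the defect
    [d] of each algebraic rule is orthogonal to the range of [f], hence d^# d = 0. *)
Definition ip_map (Y : hilbMod A) (f : Y -> B) :=
  forall x y, (f x)^# **c f y = pi <| x, y |>.

Let piB a b : pi (a - b) = pi a - pi b.
Proof. by rewrite -scaleN1r (starhomD hpi) (starhomZ hpi) scaleN1r. Qed.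

Let pi0 : pi 0 = 0.
Proof. by rewrite -(subrr 0) piB subrr. Qed.

Lemma ip_map_pi : @ip_map (selfMod A) pi.
Proof. by move=> a b; rewrite (starhomM hpi) (starhom_star hpi). Qed.

Section OneMap.
Variables (Y : hilbMod A) (f : Y -> B).
Hypothesis hf : ip_map f.

Lemma ip_mapD x y : f (x + y) = f x + f y.
Proof.
apply/eqP; rewrite -subr_eq0; apply/eqP/star_mul_eq0; set d := _ - _.
have hd z : (f z)^# **c d = 0.
  by rewrite /d cmulBr cmulDr !hf hipDr (starhomD hpi) subrr.
by rewrite {1}/d cstarB cstarD cmulBl cmulDl !hd addr0 subrr.
Qed.

Lemma ip_mapZ k x : f (k *: x) = k *: f x.
Proof.
apply/eqP; rewrite -subr_eq0; apply/eqP/star_mul_eq0; set d := _ - _.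
have hd z : (f z)^# **c d = 0.
  by rewrite /d cmulBr cmulZr !hf hipZr (starhomZ hpi) subrr.
by rewrite {1}/d cstarB cstarZ cmulBl cmulZl !hd scaler0 subrr.
Qed.

Lemma ip_map_act x a : f (x <* a) = f x **c pi a.
Proof.
apply/eqP; rewrite -subr_eq0; apply/eqP/star_mul_eq0; set d := _ - _.
have hd z : (f z)^# **c d = 0.
  by rewrite /d cmulBr cmulA !hf hipMr (starhomM hpi) subrr.
by rewrite {1}/d cstarB cstarM cmulBl -cmulA !hd cmul0r subrr.
Qed.

Lemma ip_mapN x : f (- x) = - f x.
Proof. by rewrite -scaleN1r ip_mapZ scaleN1r. Qed.

Lemma ip_mapB x y : f (x - y) = f x - f y.
Proof. by rewrite ip_mapD ip_mapN. Qed.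

Lemma ip_map_sum (I : Type) (s : seq I) (F : I -> Y) :
  f (\sum_(i <- s) F i) = \sum_(i <- s) f (F i).
Proof. exact: (big_morph f ip_mapD (morph_add0 ip_mapD)). Qed.

Lemma ip_map_bound x : nrm (f x) <= 2 * nrm x.
Proof.
rewrite -(@ler_pXn2r _ 2) ?nnegrE ?mulr_ge0 ?nrm_ge0 //.
rewrite -nrm_star_mul hf (le_trans (starhom_bound hpi _)) // nrm_hip exprMn.
by have := sqr_ge0 (nrm x); lra.
Qed.

Lemma ip_map_eq0 x : f x = 0 <-> pi <| x, x |> = 0.
Proof. by rewrite -hf; split=> [->|/star_mul_eq0//]; rewrite cmul0r. Qed.

End OneMap.

Section TensorExtension.
Variables (X : corr A) (t : X -> B).
Hypotheses (ht : ip_map t) (tl : forall a x, t (lact a x) = pi a **c t x).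
Variables (Y Z : hilbMod A) (tau : Y -> X -> Z) (f : Y -> B).
Hypotheses (hit : interior_tensor tau) (hf : ip_map f).

(** Pairs in [G] already satisfy the inner product rule, which bounds the second entry by the first,
    so the extension and its inner products are obtained together. *)
Lemma ip_map_tensor : exists2 g : Z -> B, ip_map g &
  forall y x, g (tau y x) = f y **c t x.
Proof.
pose G := [set p : Z * B | exists s : seq (Y * X),
  p = (\sum_(p <- s) tau p.1 p.2, \sum_(p <- s) f p.1 **c t p.2)].
(* Left covariance of [t] enters here: the middle factor pi <y, y'> is absorbed into [t] as a left
   action. *)
have Gip p q : G p -> G q -> p.2^# **c q.2 = pi <| p.1, q.1 |>.
  move=> [s ->] [s' ->] /=; rewrite (it_hip hit id id) cstar_sum cmul_suml.
  rewrite (big_morph pi (starhomD hpi) pi0); apply: eq_bigr => u _.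
  rewrite cmul_sumr (big_morph pi (starhomD hpi) pi0); apply: eq_bigr => v _.
  by rewrite cstarM -cmulA [(f u.1)^# **c _]cmulA hf -tl ht.
have G0 : seminorm_bound (fun (z : Z) (r : R) => nrm z <= r).
  exact: nrm_seminorm_bound.
have /choice [g hg] : forall z, exists w, forall e : R, 0 < e ->
    exists2 p, G p & nrm (z - p.1) <= e /\ nrm (w - p.2) <= e.
  move=> z; apply: (@rel_extension R Z _ B G 2 z G0) => //.
  - move=> _ _ [s ->] [s' ->]; exists (s ++ [seq (- p.1, p.2) | p <- s']) => /=.
    rewrite !big_cat !big_map /=; congr (_ + _, _ + _); rewrite -sumrN.
      by apply: eq_bigr => p _; rewrite (it_Nl hit).
    by apply: eq_bigr => p _; rewrite (ip_mapN hf) cmulNl.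
  - move=> p r r0 Gp pr; rewrite -(@ler_pXn2r _ 2) ?nnegrE ?mulr_ge0 ?nrm_ge0 //.
    rewrite -nrm_star_mul Gip // (le_trans (starhom_bound hpi _)) // nrm_hip exprMn.
    have : nrm p.1 ^+ 2 <= r ^+ 2 by rewrite lerXn2r ?nnegrE ?nrm_ge0.
    by have := sqr_ge0 r; lra.
  - by move=> e /(it_approx hit z) [s hs]; eexists; first by exists s.
have gG z p : G p -> (g z)^# **c p.2 = pi <| z, p.1 |>.
  move=> Gp; apply: (@nrm_lim _ _ _ _ (nrm p.2 + 4 * nrm p.1)) => e /(hg z) [q Gq [h1 h2]].
  rewrite (_ : _ - _ = (g z - q.2)^# **c p.2 - pi <| z - q.1, p.1 |>); last first.
    by rewrite cstarB cmulBl hipBl piB Gip // opprB addrA subrK.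
  rewrite (le_trans (nrmB _ _)) //.
  have h3 := nrm_mul (g z - q.2)^# p.2; rewrite nrm_star in h3.
  have h4 := starhom_bound hpi <| z - q.1, p.1 |>.
  have h5 := cauchy_schwarz (z - q.1) p.1.
  have h6 := ler_wpM2r (nrm_ge0 p.2) h2; have h7 := ler_wpM2r (nrm_ge0 p.1) h1; lra.
have gip : ip_map g.
  move=> z z'; apply: (@nrm_lim _ _ _ _ (nrm (g z) + 4 * nrm z)) => e /(hg z') [q Gq [h1 h2]].
  rewrite (_ : _ - _ = (g z)^# **c (g z' - q.2) - pi <| z, z' - q.1 |>); last first.
    by rewrite cmulBr hipBr piB gG // opprB addrA subrK.
  rewrite (le_trans (nrmB _ _)) //.
  have h3 := nrm_mul (g z)^# (g z' - q.2); rewrite nrm_star in h3.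
  have h4 := starhom_bound hpi <| z, z' - q.1 |>.
  have h5 := cauchy_schwarz z (z' - q.1).
  have h6 := ler_wpM2l (nrm_ge0 (g z)) h2; have h7 := ler_wpM2l (nrm_ge0 z) h1; lra.
exists g => // y x.
have Gyx : G (tau y x, f y **c t x) by exists [:: (y, x)]; rewrite !big_seq1.
apply/eqP; rewrite -subr_eq0; apply/eqP/star_mul_eq0.
have h1 := gG (tau y x) _ Gyx; have h2 := Gip _ _ Gyx Gyx; rewrite /= in h1 h2.
have h3 : (f y **c t x)^# **c g (tau y x) = pi <| tau y x, tau y x |>.
  by rewrite -[LHS]cstarK cstarM cstarK h1 -(starhom_star hpi) hip_star.
by rewrite cstarB cmulBl !cmulBr h1 h2 h3 gip !subrr.
Qed.

End TensorExtension.

(** * Images of compact operators *)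

Section OperatorImages.
Variables (Y Z : hilbMod A) (f : Y -> B) (g : Z -> B).
Hypotheses (hf : ip_map f) (hg : ip_map g).

Definition theta_img (s : seq (Z * Y)) : B := \sum_(p <- s) g p.1 **c (f p.2)^#.

(* The value at [a] of the operator representation induced by [f] and [g]: the
   second clause determines [b] on the range of [f], the first one makes [b]
   vanish on its orthogonal complement. *)
Definition op_img (a : Y -> Z) (b : B) :=
  (forall e : R, 0 < e -> exists s, nrm (b - theta_img s) <= e) /\
  forall y, b **c f y = g (a y).

Lemma theta_img_mul s y : theta_img s **c f y = g (thetas s y).
Proof.
rewrite cmul_suml thetasE (ip_map_sum hg); apply: eq_bigr => p _.
by rewrite -cmulA hf (ip_map_act hg).
Qed.

Lemma theta_img_cat s s' : theta_img (s ++ s') = theta_img s + theta_img s'.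
Proof. exact: big_cat. Qed.

(** By the approximation clause b^# is a limit of sums of f(y) g(z)^#, and [b] annihilates every
    f(y); hence b b^# = 0. *)
Lemma op_img_eq0 a b : op_img a b -> (forall y, g (a y) = 0) -> b = 0.
Proof.
move=> [hb ba] a0; apply: mul_star_eq0.
apply: (@nrm_lim _ _ _ _ (nrm b)) => e /hb [s hs]; rewrite subr0.
have bs : b **c (theta_img s)^# = 0.
  rewrite cstar_sum cmul_sumr big1 // => p _.
  by rewrite cstarM cstarK cmulA ba a0 cmul0l.
rewrite -[b^#](subrK (theta_img s)^#) cmulDr bs addr0 -cstarB.
by rewrite (le_trans (nrm_mul _ _)) // nrm_star ler_wpM2l // nrm_ge0.
Qed.

Lemma op_imgD a b a' b' : op_img a b -> op_img a' b' -> op_img (a + a') (b + b').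
Proof.
move=> [hb ba] [hb' ba']; split=> [e e0|y]; last first.
  by rewrite cmulDl ba ba' fctE (ip_mapD hg).
have e2 : 0 < e / 2 by rewrite divr_gt0.
have [s hs] := hb _ e2; have [s' hs'] := hb' _ e2; exists (s ++ s').
rewrite theta_img_cat opprD addrACA (le_trans (nrmD _ _)) //.
by have := lerD hs hs'; lra.
Qed.

Lemma op_imgZ k a b : op_img a b -> op_img (k *: a) (k *: b).
Proof.
move=> [hb ba]; split=> [e e0|y]; last first.
  by rewrite cmulZl ba fctE (ip_mapZ hg).
have kk : 0 <= complex.Re `|k| by rewrite Re_ge0.
have k0 : 0 < complex.Re `|k| + 1 by rewrite ltr_wpDl.
have [s hs] := hb _ (divr_gt0 e0 k0); exists [seq (k *: p.1, p.2) | p <- s].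
rewrite /theta_img big_map (eq_bigr (fun p => k *: (g p.1 **c (f p.2)^#))); last first.
  by move=> p _; rewrite (ip_mapZ hg) cmulZl.
rewrite -scaler_sumr -scalerBr nrmZ.
apply: le_trans (ler_wpM2l kk hs) _.
by rewrite mulrCA ler_piMr ?(ltW e0) // ler_pdivrMr // mul1r lerDl.
Qed.

Lemma op_img_uniq a b b' : op_img a b -> op_img a b' -> b = b'.
Proof.
move=> h /(op_imgZ (-1)); rewrite !scaleN1r => /(op_imgD h) hd.
apply/eqP; rewrite -subr_eq0; apply/eqP/(op_img_eq0 hd) => y.
by rewrite fctE subrr (morph_add0 (ip_mapD hg)).
Qed.

End OperatorImages.

Lemma theta_img_star (Y Z : hilbMod A) (f : Y -> B) (g : Z -> B) s :
  (theta_img f g s)^# = theta_img g f [seq (p.2, p.1) | p <- s].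
Proof.
rewrite /theta_img cstar_sum big_map; apply: eq_bigr => p _.
by rewrite cstarM cstarK.
Qed.

Section OperatorImageConstructions.
Variables (Y Z : hilbMod A) (f : Y -> B) (g : Z -> B).
Hypotheses (hf : ip_map f) (hg : ip_map g).

(** The growth argument again, in [B] as a module over itself: z j = (b b^#)^j b is a sum whose
    entries are moved by powers of F F', with F = [thetas s]. The resulting bound on b b^# b gives
    |b|^4 <= 4 M^2 |b|^2. *)
Lemma theta_img_bound s M : 0 <= M -> opb (thetas s) M ->
  nrm (theta_img f g s) <= 2 * M.
Proof.
move=> M0 hM; set b := theta_img f g s; pose F' := thetas [seq (p.2, p.1) | p <- s].
pose L := 2 * M ^+ 2; have L0 : 0 <= L by rewrite mulr_ge0 // sqr_ge0.
have FL : opb (thetas s \o F') L.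
  by have := opb_comp M0 hM (adj_opb (thetas_adj s) M0 hM); apply: opb_le; rewrite /L; lra.
pose z j : selfMod B := iter j (fun c => b **c b^# **c c) b.
have bb c d : (b **c b^# **c c)^# **c d = c^# **c (b **c b^# **c d).
  by rewrite !cstarM cstarK -!cmulA.
have zE j : z j = \sum_(p <- s) g (iter j (thetas s \o F') p.1) **c (f p.2)^#.
  elim: j => [//|j IH]; rewrite /z iterS -/(z j) IH cmul_sumr; apply: eq_bigr => p _.
  rewrite iterS /= !cmulA -[b **c b^# **c _]cmulA theta_img_star.
  by rewrite (theta_img_mul hg hf) (theta_img_mul hf hg).
have z1 : nrm (z 1) <= 2 * L * nrm (z 0).
  apply: (@hankel_bound _ _ _ _ (\sum_(p <- s) (4 * nrm p.1 * nrm p.2))) => // [i j|j].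
    by rewrite /z !iterS; exact: bb.
  rewrite zE (le_trans (nrm_sum _ _)) // mulr_suml ler_sum // => p _.
  rewrite (le_trans (nrm_mul _ _)) // nrm_star.
  have h1 := ip_map_bound hf p.2.
  have h2 : nrm (iter j (thetas s \o F') p.1) <= nrm p.1 * L ^+ j.
    elim: j => [|j IH]; first by rewrite mulr1.
    by rewrite iterS (le_trans (FL _)) // exprS mulrCA ler_wpM2l.
  have h3 := le_trans (ip_map_bound hg _) (ler_wpM2l (ler0n _ 2) h2).
  by have := ler_pM (nrm_ge0 _) (nrm_ge0 _) h3 h1; lra.
have [->|b0] := eqVneq (nrm b) 0; first by rewrite mulr_ge0.
have bp : 0 < nrm b by rewrite lt_neqAle eq_sym b0 nrm_ge0.
have h1 : nrm b ^+ 4 <= nrm (z 1) * nrm b.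
  have -> : nrm b ^+ 4 = nrm (b **c b^# **c b **c b^#).
    have := nrm_star_mul (b **c b^#); rewrite cstarM cstarK cmulA => ->.
    by have := nrm_star_mul (b^#); rewrite cstarK nrm_star => ->; rewrite -exprM.
  by rewrite (le_trans (nrm_mul _ _)) // nrm_star.
have h2 : nrm b ^+ 2 * nrm b ^+ 2 <= nrm b ^+ 2 * (2 * M) ^+ 2.
  have z0 : nrm (z 0) = nrm b by [].
  by have := ler_wpM2r (nrm_ge0 b) z1; rewrite z0 /L; lra.
rewrite -(@ler_pXn2r _ 2) ?nnegrE ?mulr_ge0 ?nrm_ge0 //.
by rewrite ler_pM2l ?exprn_gt0 in h2.
Qed.

Lemma op_img_exists a : compact_op a -> exists b, op_img f g a b.
Proof.
move=> ca; have [a' aa'] := compact_adjointable ca.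
pose G := [set p : (Y -> Z) * B | exists s, p = (thetas s, theta_img f g s)].
have [||||b hb] := @rel_extension R _ _ B G 2 a (opb_seminorm_bound Y Z).
- by [].
- move=> _ _ [s ->] [s' ->]; exists (s ++ [seq (- p.1, p.2) | p <- s']) => /=.
  rewrite thetas_cat theta_img_cat; congr (_ + _, _ + _).
    rewrite /thetas big_map -sumrN; apply: eq_bigr => p _ /=.
    by rewrite -[- p.1]scaleN1r thetaZ scaleN1r.
  rewrite /theta_img big_map -sumrN; apply: eq_bigr => p _ /=.
  by rewrite (ip_mapN hg) cmulNl.
- by move=> _ r r0 [s ->] /=; exact: theta_img_bound.
- by move=> e e0; have /compactP [_ /(_ _ e0) [s hs]] := ca; eexists; first by exists s.
exists b; split=> [e /hb [_ [s ->] /= [_ h]]|y]; first by exists s.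
apply: (@nrm_lim _ _ _ _ (nrm (f y) + 2 * nrm y)) => e /hb [_ [s ->] /= [h1 h2]].
rewrite (_ : _ - _ = (b - theta_img f g s) **c f y - g ((a - thetas s) y)); last first.
  by rewrite cmulBl (theta_img_mul hf hg) fctE (ip_mapB hg) opprB addrA subrK.
rewrite (le_trans (nrmB _ _)) //.
have h3 := nrm_mul (b - theta_img f g s) (f y).
have h4 := ip_map_bound hg ((a - thetas s) y).
have h5 := ler_wpM2r (nrm_ge0 (f y)) h2; have h6 := h1 y; lra.
Qed.

(** The difference [d] of b^# g(z) and f(a' z) is orthogonal to the range of [f], hence is killed by
    the sums approximating [b]; this forces d^# d = 0. *)
Lemma op_img_adj a a' b : op_img f g a b -> is_adjoint a a' -> op_img g f a' (b^#).
Proof.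
move=> [hb ba] aa'; split=> [e /hb [s hs]|z].
  by exists [seq (p.2, p.1) | p <- s]; rewrite -theta_img_star -cstarB nrm_star.
set c := b^# **c g z.
have orth y : (f y)^# **c (c - f (a' z)) = 0.
  by rewrite cmulBr cmulA -cstarM ba hg hf aa' subrr.
apply/eqP; rewrite -subr_eq0; apply/eqP/star_mul_eq0.
rewrite {1}cstarB cmulBl orth subr0; set d := c - _ in orth *.
apply: (@nrm_lim _ _ _ _ (nrm (g z) * nrm d)) => e /hb [s hs]; rewrite subr0.
have sd : (theta_img f g s) **c d = 0.
  by rewrite cmul_suml big1 // => p _; rewrite -cmulA orth cmul0r.
rewrite /c cstarM cstarK -cmulA -[b](subrK (theta_img f g s)) cmulDl sd addr0.
rewrite cmulA (le_trans (nrm_mul _ _)) //.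
have h1 := nrm_mul (g z)^# (b - theta_img f g s); rewrite nrm_star in h1.
have h2 := ler_wpM2l (nrm_ge0 (g z)) hs.
by rewrite [leRHS]mulrAC ler_wpM2r ?nrm_ge0 // (le_trans h1).
Qed.

Lemma op_img_ket (z : Z) : @op_img (selfMod A) Z pi g (ket z) (g z).
Proof.
split=> [e e0|a]; last by rewrite (ip_map_act hg).
have e2 : 0 < e / 2 by rewrite divr_gt0.
have [c hc] := approx_unit z e2; exists [:: (z, c^# : selfMod A)].
rewrite /theta_img big_seq1 /= -(starhom_star hpi) cstarK -(ip_map_act hg).
by rewrite -(ip_mapB hg) (le_trans (ip_map_bound hg _)) //; lra.
Qed.

End OperatorImageConstructions.

(** Only the action of [al] on the range of [f] is asked for, so the lemma covers ordinary
    composition as well as right tensoring, where [al] acts on a higher power through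
    [rtens_iter]. *)
Lemma op_img_comp (V Y Z : hilbMod A) (h : V -> B) (f : Y -> B) (g : Z -> B)
    (c : Y -> Z) (al : B) (a : V -> Y) (b : B) :
  (forall y, al **c f y = g (c y)) -> op_img h f a b -> op_img h g (c \o a) (al **c b).
Proof.
move=> hal [hb ba]; split=> [e e0|v]; last by rewrite -cmulA ba hal.
have a0 : 0 < nrm al + 1 by rewrite ltr_wpDl // nrm_ge0.
have [s hs] := hb _ (divr_gt0 e0 a0); exists [seq (c p.1, p.2) | p <- s].
rewrite (_ : theta_img _ _ _ = al **c theta_img h f s); last first.
  rewrite /theta_img big_map cmul_sumr; apply: eq_bigr => p _.
  by rewrite cmulA hal.
rewrite -cmulBr (le_trans (nrm_mul _ _)) //.
apply: le_trans (ler_wpM2l (nrm_ge0 _) hs) _.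
by rewrite mulrCA ler_piMr ?(ltW e0) // ler_pdivrMr // mul1r lerDl.
Qed.

End InnerProductMaps.

(** * From representations to right tensor representations *)

Section Powers.
Variables (R : realType) (A : cstarAlg R) (X : corr A) (P : tensorPowers X).
Variables (B : cstarAlg R) (pi : A -> B) (t : X -> B).
Hypothesis rep : representation pi t.
Let hpi := rep_hom rep.

(** Level 1 is prescribed as [t], because its values on the products [a x] need not determine it;
    the choice by [xget] starts at level 2. *)
Fixpoint tpow_rep n : tpow P n -> B :=
  match n return tpow P n -> B with
  | 0 => pi
  | k.+1 =>
    match k return (tpow P k -> B) -> tpow P k.+1 -> B with
    | 0 => fun=> t
    | j.+1 => fun f => xget (fun=> 0)
        [set g | ip_map pi g /\ forall y x, g (tens y x) = f y **c t x]
    end (@tpow_rep k)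
  end.

Lemma tpow_repP n : ip_map pi (@tpow_rep n) /\
  forall y x, @tpow_rep n.+1 (tens y x) = tpow_rep y **c t x.
Proof.
have ht : ip_map pi t by exact: rep_tip.
have ext k : ip_map pi (@tpow_rep k.+1) ->
    ip_map pi (@tpow_rep k.+2) /\
    forall y x, @tpow_rep k.+2 (tens y x) = tpow_rep y **c t x.
  move=> hk.
  have [g g1 g2] := ip_map_tensor hpi ht (rep_tlact rep) (tens_interior P k) hk.
  exact: (@xgetPex _ (fun=> 0) [set g | ip_map pi g /\
    forall y x, g (tens y x) = @tpow_rep k.+1 y **c t x]
    (ex_intro _ g (conj g1 g2))).
case: n => [|n]; first by split; [exact: ip_map_pi|exact: (rep_tlact rep)].
have hn : ip_map pi (@tpow_rep n.+1).
  by elim: n => [//|n IH]; have [] := ext n IH.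
by split=> //; have [] := ext n hn.
Qed.

Lemma tpow_rep_ip n : ip_map pi (@tpow_rep n).
Proof. by have [] := tpow_repP n. Qed.

Lemma tpow_rep_tens n (y : tpow P n) x : @tpow_rep n.+1 (tens y x) = tpow_rep y **c t x.
Proof. by have [_] := tpow_repP n. Qed.

Lemma tpow_rep_rtens n m (a : tpow P m.+1 -> tpow P n) (al : B) :
  TX P n m.+1 a -> bounded_op a -> (forall y, al **c tpow_rep y = tpow_rep (a y)) ->
  forall y, al **c @tpow_rep m.+2 y = @tpow_rep n.+1 (rtens a y).
Proof.
move=> Ta ba hal y; have [[S TS] [M M0 hM] spec] := rtensP Ta ba.
apply/eqP; rewrite -subr_eq0; apply/eqP; move: y.
pose D (y : tpow P m.+2) := al **c tpow_rep y - @tpow_rep n.+1 (rtens a y).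
apply: (@it_eq0 _ _ _ _ _ _ (tens_interior P m) _ D (nrm al * 2 + 2 * M)).
- by rewrite addr_ge0 ?mulr_ge0 ?nrm_ge0.
- move=> y z; rewrite /D (adj_add TS) !(ip_mapD hpi (@tpow_rep_ip _)) cmulDr.
  by rewrite opprD addrACA.
- move=> y; rewrite (le_trans (nrmB _ _)) // mulrDl lerD //.
    rewrite (le_trans (nrm_mul _ _)) // -mulrA ler_wpM2l ?nrm_ge0 //.
    exact: (ip_map_bound hpi (@tpow_rep_ip _)).
  by rewrite (le_trans (ip_map_bound hpi (@tpow_rep_ip _) _)) // -mulrA ler_wpM2l.
- by move=> y x; rewrite /D tpow_rep_tens cmulA hal spec tpow_rep_tens subrr.
Qed.

Lemma tpow_rep_rtens_iter k n m (a : tpow P m -> tpow P n) (al : B) :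
  KX P n m a -> op_img (@tpow_rep m) (@tpow_rep n) a al ->
  forall y, al **c @tpow_rep (k + m) y = @tpow_rep (k + n) (rtens_iter P k n m a y).
Proof.
move=> Ka [hal1 hal]; elim: k => [//|[|k] IH].
  (* At m = 0 the passage to level 1 cannot use density. There [a] is a ket, so [al] is forced to be
     a value of [tpow_rep] and the tensor rule applies directly. *)
  case: m a Ka hal1 hal IH => [|m] a Ka hal1 hal IH y.
    have [z az] := compact_ketP Ka; rewrite az in hal1 hal *.
    have -> : al = tpow_rep z.
      apply: (op_img_uniq hpi (@tpow_rep_ip n) (conj hal1 hal)).
      exact: (op_img_ket hpi (@tpow_rep_ip n)).
    rewrite -[rtens_iter _ _ _ _ _]/(rtens (ket z : tpow P 0 -> tpow P n)) rtens_ket.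
    by rewrite tpow_rep_tens.
  exact: (tpow_rep_rtens (KX_TX Ka) (compact_opb Ka)).
have [Tk bk] := rtens_iterP k.+1 Ka.
exact: (tpow_rep_rtens Tk bk).
Qed.

Definition integrated : opfamily P B := fun n m a =>
  xget 0 [set b | op_img (@tpow_rep m) (@tpow_rep n) a b].

Arguments integrated : clear implicits.

Lemma integratedE n m (a : tpow P m -> tpow P n) b :
  op_img (@tpow_rep m) (@tpow_rep n) a b -> integrated n m a = b.
Proof.
move=> hab; apply: xget_unique => // b' hab'.
exact: (op_img_uniq hpi (@tpow_rep_ip n) hab' hab).
Qed.

Lemma integratedP n m (a : tpow P m -> tpow P n) : KX P n m a ->
  op_img (@tpow_rep m) (@tpow_rep n) a (integrated n m a).
Proof.
move=> Ka; have [b hb] := op_img_exists hpi (@tpow_rep_ip m) (@tpow_rep_ip n) Ka.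
by rewrite (integratedE hb).
Qed.

Lemma integrated_integrates : integrates pi t integrated.
Proof.
split; last 2 first.
- by move=> a; apply: integratedE; exact: (op_img_ket hpi (@tpow_rep_ip 0)).
- by move=> x; apply: integratedE; exact: (op_img_ket hpi (@tpow_rep_ip 1)).
split.
- move=> n m a b Ka Kb; apply: integratedE.
  exact: (op_imgD hpi (@tpow_rep_ip n) (integratedP Ka) (integratedP Kb)).
- move=> n m k a Ka; apply: integratedE.
  exact: (op_imgZ hpi (@tpow_rep_ip n) k (integratedP Ka)).
- move=> n m a b Ka ab; symmetry; apply: integratedE.
  exact: (op_img_adj (@tpow_rep_ip m) (@tpow_rep_ip n) (integratedP Ka) ab).
- move=> n m l a b Ka Kb; symmetry; apply: integratedE.
  by apply: op_img_comp (integratedP Kb); have [] := integratedP Ka.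
- move=> k l m n a b Ka Kb; symmetry; apply: integratedE.
  apply: op_img_comp (integratedP Kb).
  exact: (tpow_rep_rtens_iter Ka (integratedP Ka)).
Qed.

End Powers.

(** * Structure of right tensor representations *)

Section TensorRepresentations.
Variables (R : realType) (A : cstarAlg R) (X : corr A) (P : tensorPowers X).
Variables (B : cstarAlg R) (rho : opfamily P B).
Arguments rho : clear implicits.
Hypothesis hrho : rtensor_rep rho.

Definition rho_pi (a : A) : B := rho 0 0 (@ket R A (tpow P 0) a).
Definition rho_t (x : X) : B := rho 1 0 (@ket R A (tpow P 1) x).

Let KX_ket n (z : tpow P n) : KX P n 0 (@ket R A (tpow P n) z).
Proof. exact: compact_ket. Qed.

Lemma KX_bra n (z : tpow P n) : KX P 0 n (fun w => <| z, w |>).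
Proof. exact: (compact_adj (compact_ket z) (ket_adj z)). Qed.

Lemma rho_bra n (z : tpow P n) :
  rho 0 n (fun w => <| z, w |>) = (rho n 0 (@ket R A (tpow P n) z))^#.
Proof. by rewrite (rtr_star hrho (KX_ket z) (ket_adj z)). Qed.

Lemma rho_ket_ip n : ip_map rho_pi (fun z : tpow P n => rho n 0 (@ket R A (tpow P n) z)).
Proof.
move=> z w; rewrite -rho_bra (rtrM hrho (KX_bra z) (KX_ket w)) /rho_pi.
by congr (rho 0 0 _); apply/funext => c; exact: hipMr.
Qed.

(** The tensor rule for k = 1 applied to two kets. For n = 0 it is the left covariance of
    [rho_t]. *)
Lemma rho_ket_tens n (z : tpow P n) (x : X) :
  rho n 0 (@ket R A (tpow P n) z) **c rho_t x
  = rho n.+1 0 (@ket R A (tpow P n.+1) (tens z x)).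
Proof.
have Kx : KX P (1 + 0) 0 (@ket R A (tpow P 1) x) by exact: compact_ket.
rewrite /rho_t (rtr_tens (k := 1) hrho (KX_ket z) Kx).
congr (rho n.+1 0 _); rewrite /= rtens_ket; apply/funext => c.
have [S zS] := tens_adjointable z.
exact: (adj_act zS).
Qed.

Lemma rho_ket_op n m (a : tpow P m -> tpow P n) (z : tpow P m) : KX P n m a ->
  rho n m a **c rho m 0 (@ket R A (tpow P m) z) = rho n 0 (@ket R A (tpow P n) (a z)).
Proof.
move=> Ka; rewrite (rtrM hrho Ka (KX_ket z)); congr (rho n 0 _).
have [S aS] := compact_adjointable Ka.
by apply/funext => c; exact: (adj_act aS).
Qed.

Lemma rho_pi_hom : starhom rho_pi.
Proof.
have kD (Z : hilbMod A) (z w : Z) : ket (z + w) = ket z + ket w.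
  by apply/funext => c; rewrite fctE /ket hactDl.
have kZ (Z : hilbMod A) k (z : Z) : ket (k *: z) = k *: ket z.
  by apply/funext => c; rewrite fctE /ket hactZl.
split.
- by move=> a b; rewrite /rho_pi -(rtrD hrho) // -kD.
- by move=> k a; rewrite /rho_pi -(rtrZ hrho) // -kZ.
- move=> a b; rewrite /rho_pi (rtrM hrho) //; congr (rho 0 0 _).
  exact: (@ket_act R A (selfMod A)).
- move=> a; have := rho_bra (a : tpow P 0); rewrite /rho_pi => <-.
  by [].
Qed.

Lemma rho_representation : representation rho_pi rho_t.
Proof.
have ip1 := @rho_ket_ip 1.
split; first exact: rho_pi_hom.
- exact: (ip_mapD rho_pi_hom ip1).
- exact: (ip_mapZ rho_pi_hom ip1).
- exact: (ip_map_act rho_pi_hom ip1).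
- exact: ip1.
- by move=> a x; rewrite /rho_t -(@rho_ket_tens 0).
Qed.

Lemma rho_theta n m (z : tpow P n) (y : tpow P m) :
  rho n m (theta z y) = rho n 0 (@ket R A (tpow P n) z) **c (rho m 0 (@ket R A (tpow P m) y))^#.
Proof. by rewrite -rho_bra (rtrM hrho (KX_ket z) (KX_bra y)). Qed.

Let KXN n m (a : tpow P m -> tpow P n) : KX P n m a -> KX P n m (- a).
Proof.
move=> Ka; have -> : - a = a \o -%R.
  by have [S aS] := compact_adjointable Ka; apply/funext => y /=; rewrite (adj_opp aS).
have NN : is_adjoint (-%R : tpow P m -> tpow P m) -%R.
  by move=> y z; rewrite hipNl hipNr.
by apply: (compact_comp Ka NN ler01) => y; rewrite mul1r nrmN.
Qed.

Let rhoB n m (a b : tpow P m -> tpow P n) : KX P n m a -> KX P n m b ->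
  rho n m (a - b) = rho n m a - rho n m b.
Proof.
move=> Ka Kb; rewrite (rtrD hrho Ka (KXN Kb)) -(scaleN1r b) (rtrZ hrho) //.
by rewrite scaleN1r.
Qed.

(** The operator [k] is again compact, so [rho] transports the relation between [h] and [k] to left
    multiplications on [B], where [unitary_trick] applies. *)
Lemma rho_contractive n (h : tpow P n -> tpow P n) :
  KX P n n h -> is_adjoint h h -> opb h 2^-1 -> nrm (rho n n h) <= 1.
Proof.
move=> Kh hh h1; have [k [Kk kk kh hk]] := sqrt_op (closed_alg_compact _) Kh hh h1.
have [S hS] := compact_adjointable Kh.
have hM (f g : tpow P n -> tpow P n) (b : B) : KX P n n f -> KX P n n g ->
    rho n n f **c (rho n n g **c b) = rho n n (f \o g) **c b.
  by move=> Kf Kg; rewrite cmulA (rtrM hrho).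
have Kkk : KX P n n (k \o k) by exact: (ca_comp (closed_alg_compact _)).
have [||||hb _] := @unitary_trick R B (selfMod B) (cmul (rho n n h)) (cmul (rho n n k)).
- by move=> b c /=; rewrite cstarM (rtr_star hrho Kh hh) cmulA.
- by move=> b c /=; rewrite cstarM (rtr_star hrho Kk kk) cmulA.
- by apply/funext => b /=; rewrite !hM // kh.
- move=> b; rewrite !hM // -cmulDl -cmulBl -(rtrD hrho) // -rhoB //; last exact: compactD.
  by congr (rho n n _ **c b); apply/funext => y; rewrite /= hk.
apply: sqr_le_mul; rewrite ?nrm_ge0 // -nrm_star -nrm_star_mul cstarK.
exact: hb.
Qed.

(** The C*-identity reduces to a' a, which is bounded by 2 M^2; the scale 1 / (4 M^2) brings it to
    the bound 1/2 of [rho_contractive]. *)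
Lemma rho_bound n m (a : tpow P m -> tpow P n) (M : R) :
  0 < M -> KX P n m a -> opb a M -> nrm (rho n m a) <= 2 * M.
Proof.
move=> M0 Ka hM; have [a' aa'] := compact_adjointable Ka.
have Ka' : KX P m n a' by exact: compact_adj Ka aa'.
have Kaa : KX P m m (a' \o a) by exact: compact_comp Ka' aa' (ltW M0) hM.
pose s := (4 * M ^+ 2)^-1.
have s1 : 0 < 4 * M ^+ 2 by rewrite mulr_gt0 // exprn_gt0.
have s0 : 0 < s by rewrite invr_gt0.
have Ks : KX P m m (s *r (a' \o a)) by exact: (ca_scale (closed_alg_compact _)).
have sh : opb (s *r (a' \o a)) 2^-1.
  have M2 : 0 <= 2 * M by rewrite mulr_ge0 // ltW.
  have := opbZ s (opb_comp M2 (adj_opb aa' (ltW M0) hM) hM); apply: opb_le.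
  by rewrite gtr0_norm // /s mulrC ler_pdivrMr //; lra.
have := rho_contractive Ks (adj_funZr s (adj_comp (adj_sym aa') aa')) sh.
rewrite (rtrZ hrho) // nrmZr gtr0_norm // /s mulrC ler_pdivrMr // mul1r.
rewrite -(rtrM hrho Ka' Ka) -(rtr_star hrho Ka aa') nrm_star_mul => h.
rewrite -(@ler_pXn2r _ 2) ?nnegrE ?mulr_ge0 ?nrm_ge0 ?(ltW M0) // exprMn.
by rewrite (le_trans h) // -natrX.
Qed.

(** Continuity and the values on [theta] put every right tensor representation under the
    characterisation [op_img] relative to its own kets, so uniqueness reduces to kets. *)
Lemma rho_op_img n m (a : tpow P m -> tpow P n) : KX P n m a ->
  op_img (fun z => rho m 0 (@ket R A (tpow P m) z))
    (fun z => rho n 0 (@ket R A (tpow P n) z)) a (rho n m a).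
Proof.
move=> Ka; split=> [e e0|z]; last exact: rho_ket_op.
have e2 : 0 < e / 2 by rewrite divr_gt0.
have /compactP [_ /(_ _ e2) [s hs]] := Ka; exists s.
have [Ks <-] : KX P n m (thetas s) /\
    rho n m (thetas s) = theta_img (fun z => rho m 0 (@ket R A (tpow P m) z))
      (fun z => rho n 0 (@ket R A (tpow P n) z)) s.
  elim: s {hs} => [|p s [Ks IH]].
    rewrite thetas_nil /theta_img big_nil -(subrr a); split.
      by apply: compactD => //; exact: KXN.
    by rewrite rhoB // subrr.
  have Kp : KX P n m (theta p.1 p.2) by exact: compact_theta.
  rewrite thetas_cons; split; first exact: compactD.
  by rewrite (rtrD hrho) // IH rho_theta /theta_img big_cons.
rewrite -rhoB //; apply: le_trans (rho_bound e2 _ hs) _; last lra.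
by apply: compactD => //; exact: KXN.
Qed.

End TensorRepresentations.

Section Integrated.
Variables (R : realType) (A : cstarAlg R) (X : corr A) (P : tensorPowers X).
Variables (B : cstarAlg R) (pi : A -> B) (t : X -> B) (rho : opfamily P B).
Arguments rho : clear implicits.
Hypotheses (rep : representation pi t) (int : integrates pi t rho).
Let hpi := rep_hom rep.

(** From power 2 on, both sides are additive, bounded and obey the same rule on simple tensors,
    whose span is dense; powers 0 and 1 are prescribed. *)
Lemma integrates_ket n (z : tpow P n) :
  rho n 0 (@ket R A (tpow P n) z) = tpow_rep pi t z.
Proof.
have [hrho pi0 t1] := int.
have ip k : ip_map pi (fun z : tpow P k => rho k 0 (@ket R A (tpow P k) z)).
  by move=> x y; rewrite rho_ket_ip // /rho_pi pi0.
case: n z => [|n] z; first exact: pi0.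
elim: n z => [|n IH] z; first exact: t1.
have ip' := tpow_rep_ip (P := P) (n := n.+2) rep.
apply/eqP; rewrite -subr_eq0; apply/eqP; move: z.
pose D (z : tpow P n.+2) := rho n.+2 0 (@ket R A (tpow P n.+2) z) - tpow_rep pi t z.
apply: (@it_eq0 _ _ _ _ _ _ (tens_interior P n) _ D (2 + 2)); first exact: addr_ge0.
- by move=> y z; rewrite /D (ip_mapD hpi (ip _)) (ip_mapD hpi ip') opprD addrACA.
- move=> y; rewrite (le_trans (nrmB _ _)) // mulrDl lerD //.
    exact: (ip_map_bound hpi (ip _)).
  exact: (ip_map_bound hpi ip').
- move=> y x; rewrite /D (tpow_rep_tens rep y) -IH -(rho_ket_tens hrho y).
  by rewrite /rho_t t1 subrr.
Qed.

Lemma integrates_op_img n m (a : tpow P m -> tpow P n) : KX P n m a ->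
  op_img (@tpow_rep _ _ _ P _ pi t m) (@tpow_rep _ _ _ P _ pi t n) a (rho n m a).
Proof.
have [hrho _ _] := int => /(rho_op_img hrho).
rewrite (_ : (fun z => rho m 0 _) = @tpow_rep _ _ _ P _ pi t m); last first.
  by apply/funext => z; exact: integrates_ket.
rewrite (_ : (fun z => rho n 0 _) = @tpow_rep _ _ _ P _ pi t n) //.
by apply/funext => z; exact: integrates_ket.
Qed.

End Integrated.

(** * Kernels *)

Section Kernel.
Variables (R : realType) (A : cstarAlg R).

Lemma thetas_approx (Y Z : hilbMod A) (D : set Z) (s : seq (Z * Y)) :
  (forall p, p \in s -> forall e : R, 0 < e -> exists2 z, D z & nrm (p.1 - z) <= e) ->
  forall e : R, 0 < e -> exists2 s' : seq (Z * Y),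
    (forall p, p \in s' -> D p.1) & opb (thetas s - thetas s') e.
Proof.
elim: s => [|p s IH] hs e e0.
  by exists [::] => //; rewrite subrr; apply: opb0; exact: ltW.
have e2 : 0 < e / 2 by rewrite divr_gt0.
have [|s' Ds' hs'] := IH _ _ e2.
  by move=> q qs; apply: hs; rewrite inE qs orbT.
have y0 : 0 < 2 * nrm p.2 + 1 by rewrite ltr_wpDl // mulr_ge0 // nrm_ge0.
have [z Dz hz] := hs p (mem_head _ _) _ (divr_gt0 e2 y0).
exists ((z, p.2) :: s') => [q|].
  by rewrite inE => /orP [/eqP ->|/Ds'].
rewrite !thetas_cons opprD addrACA.
have -> : theta p.1 p.2 - theta z p.2 = theta (p.1 - z) p.2.
  by apply/funext => w; rewrite fctE /theta hactBl.
apply: opb_le (opbD (theta_opb _ _) hs').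
suff : 2 * nrm (p.1 - z) * nrm p.2 <= e / 2 by lra.
have := ler_wpM2r (nrm_ge0 p.2) hz => h.
have : e / 2 / (2 * nrm p.2 + 1) * (2 * nrm p.2) <= e / 2.
  by rewrite mulrAC ler_pdivrMr // ler_pM2l // lerDl.
lra.
Qed.

Lemma ker_closed_subalg (B : cstarAlg R) (pi : A -> B) : starhom pi ->
  closed_subalg [set a | pi a = 0].
Proof.
move=> hpi; split => /= [a b a0 b0|r a a0|a b a0 b0|a ha].
- by rewrite (starhomD hpi) a0 b0 addr0.
- by rewrite (starhomZ hpi) a0 scaler0.
- by rewrite (starhomM hpi) a0 cmul0l.
- apply: (@nrm_lim _ _ _ _ 2) => e /ha [b /= b0 hb]; rewrite subr0.
  rewrite -[a](subrK b) (starhomD hpi) b0 addr0.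
  by rewrite (le_trans (starhom_bound hpi _)) // ler_wpM2l.
Qed.

Lemma mod_idealZ (I : set A) (Z : hilbMod A) (k : R[i]) (z : Z) :
  mod_ideal I z -> mod_ideal I (k *: z).
Proof. by move=> [w [a [Ia ->]]]; exists (k *: w), a; rewrite hactZl. Qed.

(** For the converse, a finite rank approximation of [a] itself may leave the range of [a].
    Approximating a compact right unit [u] of [a] instead gives sums with first entries a(y), whose
    inner squares lie in ker pi and which are therefore limits of a(y) c with [c] in ker pi. The
    three approximations cost e / 3 each. *)
Lemma compact_into_idealP (B : cstarAlg R) (pi : A -> B) (Y Z : hilbMod A)
    (g : Z -> B) (a : Y -> Z) : starhom pi -> ip_map pi g ->
  compact_into (mod_ideal [set a | pi a = 0]) a <->
  compact_op a /\ forall y, g (a y) = 0.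
Proof.
move=> hpi hg; have hI := ker_closed_subalg hpi.
set I := [set a | _] in hI *.
rewrite (compact_intoP _ (@mod_idealZ I Z)); split.
  move=> [aa ha]; split.
    by apply/compactP; split=> // e /ha [s _ hs]; exists s.
  move=> y; apply: (@nrm_lim _ _ _ _ (2 * nrm y)) => e /ha [s sI hs].
  have s0 : g (thetas s y) = 0.
    rewrite thetasE (ip_map_sum hpi hg) big_seq big1 // => p /sI [w [c [/= c0 ->]]].
    by rewrite !(ip_map_act hpi hg) c0 cmul0r cmul0l.
  rewrite -s0 -(ip_mapB hpi hg) (le_trans (ip_map_bound hpi hg _)) //.
  by have := hs y; rewrite fctE; lra.
move=> [ca a0]; split; first exact: compact_adjointable.
move=> e e0; have e3 : 0 < e / 3 by rewrite divr_gt0.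
have [u cu hu] := compact_approx_unit ca e3.
have [M M0 hM] := compact_opb ca.
have M1 : 0 < M + 1 by rewrite ltr_wpDl.
have /compactP [_ /(_ _ (divr_gt0 e3 M1)) [s hs]] := cu.
have [S aS] := compact_adjointable ca.
pose s1 := [seq (a p.1, p.2) | p <- s].
have as1 : a \o thetas s = thetas s1.
  apply/funext => y; rewrite /= !thetasE (adj_sum aS) big_map.
  by apply: eq_bigr => p _; rewrite (adj_act aS).
have [|s2 s2D hs2] := @thetas_approx _ _ (mod_ideal I) s1 _ _ e3.
  move=> _ /mapP [p _ ->] d d0 /=.
  have Ip : I <| a p.1, a p.1 |> by apply/(ip_map_eq0 hg).
  have [c Ic hc] := approx_unit_module hI Ip d0.
  by exists (a p.1 <* c) => //; exists (a p.1), c.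
exists s2 => //.
have h2 : opb ((a \o u) - thetas s1) (e / 3).
  rewrite -as1 (_ : _ - _ = a \o (u - thetas s)); last first.
    by apply/funext => y; rewrite !fctE /= (adj_sub aS).
  apply: opb_le (opb_comp M0 hM hs).
  by rewrite mulrCA ler_piMr ?(ltW e3) // ler_pdivrMr // mul1r lerDl.
by apply: opb_le (opb_dist (opb_dist hu h2) hs2); lra.
Qed.

End Kernel.

Theorem proposition3p13 (R : realType) (A : cstarAlg R) (X : corr A)
    (P : tensorPowers X) (B : cstarAlg R) :
  (* existence and uniqueness of [pi, t] *)
  (forall (pi : A -> B) (t : X -> B), representation pi t ->
     (exists rho : opfamily P B, integrates pi t rho) /\
     (forall rho rho' : opfamily P B,
        integrates pi t rho -> integrates pi t rho' -> eq_onKX rho rho')) /\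
  (* every right tensor representation is of the form [pi, t] *)
  (forall rho : opfamily P B, rtensor_rep rho ->
     exists (pi : A -> B) (t : X -> B),
       representation pi t /\ integrates pi t rho) /\
  (* the kernel of [pi, t] *)
  (forall (pi : A -> B) (t : X -> B) (rho : opfamily P B),
     representation pi t -> integrates pi t rho ->
     forall n m : nat,
       rtr_ker rho n m = KXideal P [set a | pi a = 0] n m).
Proof.
split; [|split].
- move=> pi t rep; split; first by exists (integrated pi t); exact: integrated_integrates.
  move=> rho rho' int int' n m a Ka.
  apply: (op_img_uniq (rep_hom rep) (tpow_rep_ip (P := P) (n := n) rep)).
    exact: (integrates_op_img rep int Ka).
  exact: (integrates_op_img rep int' Ka).
- move=> rho hrho; exists (rho_pi rho), (rho_t rho); split; first exact: rho_representation.
  by split.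
- move=> pi t rho rep int n m.
  have ipn := tpow_rep_ip (P := P) (n := n) rep.
  apply/seteqP; split=> a /=.
    move=> [Ka a0]; apply/(compact_into_idealP a (rep_hom rep) ipn); split=> // y.
    (* The kernel condition is tested on vectors: t^n(a y) = rho(a) t^m(y), and the converse
       direction is [op_img_eq0]. *)
    by have [_ <-] := integrates_op_img rep int Ka; rewrite a0 cmul0l.
  move/(compact_into_idealP a (rep_hom rep) ipn) => [Ka a0]; split=> //.
  exact: (op_img_eq0 (integrates_op_img rep int Ka) a0).
Qed.
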